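(* Consider the function on the unit ball $B_1\subset\mathbb{R}^2$ given in polar coordinates by $$u(r,\varphi)=r^{\frac52}\left(\cos\frac{\varphi}{2}-\frac15\cos\frac{5\varphi}{2}\right),\qquad r\in[0,1),\ \varphi\in[-\pi,\pi).$$ Then $u\in C^{2,\frac12}$ and $u$ is the solution to the biharmonic zero-obstacle problem in $B_1$, that is, $u$ is the unique minimiser of $J[v]=\int_{B_1}(\Delta v)^2dx$ over $$\mathscr{A}=\left\{v\in W^{2,2}(B_1):\ v\ge0,\ v=u\ \text{and}\ \frac{\partial v}{\partial n}=\frac{\partial u}{\partial n}\ \text{on }\partial B_1\right\}.$$
   Context: $B_1$ is the open unit disc centred at the origin of $\mathbb{R}^2$; $\frac{\partial}{\partial n}$ is the outer normal derivative on $\partial B_1$; boundary conditions are understood in the trace sense, with the boundary values of $u$ given by the same formula at $r=1$. *)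

(* Defs.v *)
From HB Require Import structures.
From mathcomp Require Import all_boot all_order all_algebra.
From mathcomp Require Import all_classical all_reals all_analysis.
Set Implicit Arguments.
Unset Strict Implicit.
Unset Printing Implicit Defensive.
Import Order.TTheory GRing.Theory Num.Theory.
Import numFieldNormedType.Exports.
Local Open Scope classical_set_scope.
Local Open Scope ring_scope.

(* The plane is R * R; its library norm is the sup norm, so the Euclidean
   length is introduced separately. *)
Definition enorm (R : realType) (p : R * R) : R :=
  Num.sqrt (p.1 ^+ 2 + p.2 ^+ 2).

Definition disc (R : realType) : set (R * R) := [set p | enorm p < 1].
Arguments disc : clear implicits.

Definition leb2 (R : realType) :=
  (@lebesgue_measure R \x @lebesgue_measure R)%E.
Arguments leb2 : clear implicits.

(* Coordinate directions are indexed by bool: false is x_1, true is x_2. *)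
Definition basis (R : realType) (i : bool) : R * R :=
  if i then (0, 1) else (1, 0).

Definition partial (R : realType) (i : bool) (f : R * R -> R) : R * R -> R :=
  fun x => 'D_(basis R i) f x.

(* C^k(U), for U open. *)
Fixpoint Ck (R : realType) (U : set (R * R)) (k : nat) (f : R * R -> R) : Prop :=
  (forall x, U x -> {for x, continuous f}) /\
  match k with
  | 0 => True
  | k'.+1 => forall i, (forall x, U x -> derivable f x (basis R i)) /\
                       Ck U k' (partial i f)
  end.

(* C^{k,a}(U) with finite norm over the whole of U: all derivatives of order at
   most k are continuous and bounded on U, those of order k are a-Hoelder. *)
Fixpoint CkHolder (R : realType) (U : set (R * R)) (a : R) (k : nat)
    (f : R * R -> R) : Prop :=
  [/\ (forall x, U x -> {for x, continuous f}),
      (exists C : R, forall x, U x -> `|f x| <= C) &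
  match k with
  | 0 => exists C : R, forall x y, U x -> U y ->
           `|f x - f y| <= C * enorm (x - y) `^ a
  | k'.+1 => forall i, (forall x, U x -> derivable f x (basis R i)) /\
                       CkHolder U a k' (partial i f)
  end].

Definition test_function (R : realType) (f : R * R -> R) : Prop :=
  (forall k, Ck setT k f) /\
  exists K : set (R * R), [/\ compact K, K `<=` disc R &
                              forall x, ~ K x -> f x = 0].

Definition L2 (R : realType) (f : R * R -> R) : Prop :=
  measurable_fun (disc R) f /\
  (\int[leb2 R]_(x in disc R) (f x ^+ 2)%:E < +oo)%E.

Definition is_weak_partial (R : realType) (i : bool) (f g : R * R -> R) : Prop :=
  [/\ L2 f, L2 g & forall phi, test_function phi ->
    \int[leb2 R]_(x in disc R) (f x * partial i phi x) =
    - \int[leb2 R]_(x in disc R) (g x * phi x)].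

(* The Sobolev space W^{k,2} of the unit disc. *)
Fixpoint sobolev (R : realType) (k : nat) (f : R * R -> R) : Prop :=
  L2 f /\
  match k with
  | 0 => True
  | k'.+1 => forall i, exists2 g, is_weak_partial i f g & sobolev k' g
  end.

(* A chosen representative of the weak derivative (which is unique up to null
   sets); it is the zero function if f has no weak derivative in L^2. *)
Definition weak_partial (R : realType) (i : bool) (f : R * R -> R) :
    R * R -> R :=
  xget (fun=> 0) [set g | is_weak_partial i f g].

Definition weak_laplacian (R : realType) (v : R * R -> R) : R * R -> R :=
  fun x => \sum_(i : bool) weak_partial i (weak_partial i v) x.

Definition bienergy (R : realType) (v : R * R -> R) : \bar R :=
  (\int[leb2 R]_(x in disc R) (weak_laplacian v x ^+ 2)%:E)%E.

(* Functions on the unit circle are functions of the angle in [-pi, pi], for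
   which arc length is Lebesgue measure. *)
Definition circle_pt (R : realType) (t : R) : R * R := (cos t, sin t).

(* The graph of the trace operator on W^{1,2}: the closure, in
   W^{1,2}(disc) x L^2(circle), of the restriction map on functions that are
   C^1 up to the boundary. *)
Definition has_trace (R : realType) (w : R * R -> R) (g : R -> R) : Prop :=
  [/\ sobolev 1 w,
      measurable_fun (`[- pi, pi] : set R) g,
      (\int[@lebesgue_measure R]_(t in `[(- pi)%R, pi%R]) (g t ^+ 2)%:E < +oo)%E &
      exists phi : nat -> R * R -> R,
      [/\ (forall k, Ck setT 1 (phi k)),
          (\int[leb2 R]_(x in disc R) ((phi k x - w x) ^+ 2)%:E)%E
            @[k --> \oo] --> 0%E,
          (forall i, (\int[leb2 R]_(x in disc R)
              ((partial i (phi k) x - weak_partial i w x) ^+ 2)%:E)%E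
            @[k --> \oo] --> 0%E) &
          (\int[@lebesgue_measure R]_(t in `[(- pi)%R, pi%R])
              ((phi k (circle_pt t) - g t) ^+ 2)%:E)%E
            @[k --> \oo] --> 0%E]].

(* The normal derivative of v in the trace sense is g : the trace of the
   weak gradient, dotted with the outer normal (cos t, sin t). *)
Definition has_normal_trace (R : realType) (v : R * R -> R) (g : R -> R) : Prop :=
  exists h : bool -> R -> R,
    (forall i, has_trace (weak_partial i v) (h i)) /\
    {ae @lebesgue_measure R, forall t : R, - pi <= t <= pi ->
      h false t * cos t + h true t * sin t = g t}.

(* Classical outer normal derivative at the boundary point of angle t of a
   function on the closed disc: a one-sided limit from inside. *)
Definition normal_derivative (R : realType) (u : R * R -> R) (t : R) : R :=
  lim ((u (r * cos t, r * sin t) - u (cos t, sin t)) / (r - 1) @[r --> 1^'-]).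

(* Competitors with the boundary data of u and zero obstacle. *)
Definition admissible (R : realType) (u : R * R -> R) : set (R * R -> R) :=
  [set v | [/\ sobolev 2 v,
               {ae leb2 R, forall x, disc R x -> 0 <= v x},
               has_trace v (fun t => u (circle_pt t)) &
               has_normal_trace v (normal_derivative u)]].

Definition minimiser (R : realType) (J : (R * R -> R) -> \bar R)
    (A : set (R * R -> R)) (v : R * R -> R) : Prop :=
  A v /\ forall w, A w -> (J v <= J w)%E.

(* Main.v *)
Require Import Defs.
From HB Require Import structures.
From mathcomp Require Import all_boot all_order all_algebra.
From mathcomp Require Import all_classical all_reals all_analysis.
From mathcomp Require Import measurable_realfun ring lra.
Import Defs.
Import Order.TTheory GRing.Theory Num.Theory.
Import numFieldNormedType.Exports.
Local Open Scope classical_set_scope.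
Local Open Scope ring_scope.
Set Implicit Arguments.
Unset Strict Implicit.
Unset Printing Implicit Defensive.

(* Write r = |p| and xi = sqrt ((r + x) / 2) = sqrt r * cos (phi / 2). Then
   u = 4 r xi^3 - (16/5) xi^5 >= 0 is C^{2,1/2} on the whole plane, with gradient
   (2 xi^3, 3 y xi) and Laplacian 6 xi. The latter is subharmonic and harmonic
   off the slit {y = 0, x <= 0}, where u vanishes. For a competitor v put
   w = v - u: it has zero trace and zero normal trace. Approximate 6 xi uniformly
   by the smooth subharmonic functions Q_e obtained by replacing r with
   sqrt (r^2 + e^2). Green's formula gives
   int Q_e Lap w = int w Lap Q_e >= - int u Lap Q_e >= - C e,
   because u Lap Q_e <= 15 e / 2 pointwise; letting e -> 0, int Lap u Lap w >= 0,
   so J[v] >= J[u] + int (Lap w)^2. In case of equality Lap w = 0, and Green's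
   formula yields first grad w = 0 and then w = 0. *)

(** * Calculus of C^k functions on the plane *)

(** The formula for [u] is an Almansi decomposition: with z = x + iy it reads |z|^2 Re z^(1/2) -
    (1/5) Re z^(5/2), and Lap (|z|^2 h) = 4 h + 4 (1/2) h for h harmonic and homogeneous of degree
    1/2, whence the 6 in 6 xi. The coefficient 1/5 removes the linear term of the quintic polynomial
    in cos (phi / 2), so [u] vanishes to third order in xi on the slit. This gives both the C^2
    gluing across the slit and the cancellation in u Lap Q_e.

    6 xi itself cannot be a weight in Green's formula: its distributional Laplacian is a positive
    measure on the slit, and integrating [v] there would need pointwise values of a Sobolev
    function. With Q_e only integrals over the disc occur, and v >= 0 almost everywhere suffices.

    A weak derivative is an arbitrary choice in its class, hence not linear pointwise. The
    difference w is therefore carried together with its derivatives and traces ([traceable]), and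
    uniqueness of weak derivatives serves to identify those chosen for [u] with the explicit
    ones. *)

Section Derivatives.
Variables (R : realType) (V : normedModType R).
Implicit Types (f g : V -> R) (p v : V).

Lemma is_derive_add f g p v (a b : R) :
  is_derive p v f a -> is_derive p v g b ->
  is_derive p v (fun x => f x + g x) (a + b).
Proof. exact: is_deriveD. Qed.

Lemma is_derive_opp f p v (a : R) :
  is_derive p v f a -> is_derive p v (fun x => - f x) (- a).
Proof. exact: is_deriveN. Qed.

Lemma is_derive_mul f g p v (a b : R) :
  is_derive p v f a -> is_derive p v g b ->
  is_derive p v (fun x => f x * g x) (a * g p + f p * b).
Proof.
move=> fa gb; apply: is_derive_eq (is_deriveM fa gb) _.
by rewrite addrC /GRing.scale /= [g p * a]mulrC.
Qed.

Lemma is_derive_inv f p v (a : R) : f p != 0 ->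
  is_derive p v f a -> is_derive p v (fun x => (f x)^-1) (- a / f p ^+ 2).
Proof.
move=> fp [fd <-]; apply: DeriveDef; first exact: derivableV.
by rewrite deriveV// /GRing.scale /= !mulNr mulrC.
Qed.

(** Restricting [f] to the line t |-> t v + p reduces this to the one-variable chain rule, so that
    only the directional derivative of [f] has to exist. *)
Lemma is_derive_comp (h : R -> R) f p v (a b : R) :
  is_derive p v f a -> is_derive (f p) 1 h b ->
  is_derive p v (fun x => h (f x)) (b * a).
Proof.
move=> [fd fa] [hd hb].
pose s := fun t : R => f (t *: v + p).
have sd : derivable s 0 1 by exact: (derivable1P f p v).1 fd.
have s0 : s 0 = f p by rewrite /s scale0r add0r.
have hd' : derivable h (s 0) 1 by rewrite s0.
have dE (q : V -> R) : 'D_v q p = derive1 (fun t : R => q (t *: v + p)) 0.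
  rewrite derive1E /derive; set F := (X in lim (X @ _)).
  set G := (X in _ = lim (X @ _)); suff -> : F = G by [].
  apply/funext => t; rewrite /F /G /=.
  by rewrite addr0 scale0r add0r [_%:A]mulr1.
have H := derive1_comp sd hd'.
apply: DeriveDef.
  apply: (derivable1P (fun x => h (f x)) p v).2; rewrite -[X in derivable X]/(h \o s).
  apply/derivable1_diffP/differentiable_comp; exact/derivable1_diffP.
rewrite dE -[X in derive1 X]/(h \o s) H derive1E s0 hb; congr (_ * _).
by rewrite -dE.
Qed.

Lemma is_derive_cvg f p v (a : R) :
  t^-1 * (f (t *: v + p) - f p) @[t --> 0^'] --> a -> is_derive p v f a.
Proof.
by move=> fa; apply: DeriveDef; [exact: cvgP fa|exact: cvg_lim fa].
Qed.

Lemma is_derive_sqrt f p v (a : R) : 0 < f p ->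
  is_derive p v f a ->
  is_derive p v (fun x => Num.sqrt (f x)) (a / (2 * Num.sqrt (f p))).
Proof.
move=> fp fa; have H := is_derive1_sqrt fp.
by apply: is_derive_eq (is_derive_comp fa H) _; rewrite mulrC.
Qed.

End Derivatives.

Section CkCalculus.
Variable R : realType.
Implicit Types (f g : R * R -> R) (p v : R * R) (i : bool) (k : nat).

Lemma is_derive_fst p i : is_derive p (basis R i) fst (basis R i).1.
Proof.
apply: is_derive_cvg; apply: cvg_near_cst.
near=> t => /=; have t0 : t != 0 by near: t; exact: nbhs_dnbhs_neq.
by rewrite addrK /GRing.scale /= mulrA mulVf// mul1r.
Unshelve. all: by end_near. Qed.

Lemma is_derive_snd p i : is_derive p (basis R i) snd (basis R i).2.
Proof.
apply: is_derive_cvg; apply: cvg_near_cst.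
near=> t => /=; have t0 : t != 0 by near: t; exact: nbhs_dnbhs_neq.
by rewrite addrK /GRing.scale /= mulrA mulVf// mul1r.
Unshelve. all: by end_near. Qed.

(** The derivatives enter as explicit functions, so smoothness proofs need not compute [partial]
    beforehand. *)
Lemma CkSI k f (df : bool -> R * R -> R) : continuous f ->
  (forall i p, is_derive p (basis R i) f (df i p)) ->
  (forall i, Ck setT k (df i)) -> Ck setT k.+1 f.
Proof.
move=> cf fd dk; split => [x _|i]; first exact: cf.
split=> [x _|]; first by case: (fd i x).
suff -> : partial i f = df i by [].
by apply/funext => x; rewrite /partial; case: (fd i x).
Qed.

Lemma Ck_continuous k f : Ck setT k f -> continuous f.
Proof. by case: k => [|k] [cf _] x; exact: cf. Qed.

Lemma CkS_is_derive k f i p : Ck setT k.+1 f ->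
  is_derive p (basis R i) f (partial i f p).
Proof. by case=> _ /(_ i)[fd _]; apply: derivableP; exact: fd. Qed.

Lemma CkS_partial k f i : Ck setT k.+1 f -> Ck setT k (partial i f).
Proof. by case=> _ /(_ i)[]. Qed.

Lemma CkW k f : Ck setT k.+1 f -> Ck setT k f.
Proof.
elim: k f => [|k IH] f fk; first by split=> // x _; exact: (Ck_continuous fk).
apply: (@CkSI k f (fun i => partial i f)) => [|i p|i].
- exact: Ck_continuous fk.
- exact: CkS_is_derive fk.
- by apply: IH; exact: CkS_partial fk.
Qed.

Lemma Ck_le k l f : (l <= k)%N -> Ck setT k f -> Ck setT l f.
Proof.
move=> /subnK <-; elim: (k - l)%N => [//|n IH].
by rewrite addSn => /CkW /IH.
Qed.

Lemma continuous_Ck0 f : continuous f -> Ck setT 0 f.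
Proof. by move=> cf; split=> // x _; exact: cf. Qed.

Lemma Ck_cst k (c : R) : Ck setT k (fun=> c : R).
Proof.
elim: k c => [|k IH] c; first by apply: continuous_Ck0 => x; exact: cvg_cst.
apply: (@CkSI k _ (fun=> fun=> 0)) => [x|i]; [exact: cvg_cst|exact: IH].
Qed.

Lemma Ck_fst k : Ck setT k (@fst R R).
Proof.
case: k => [|k]; first by apply: continuous_Ck0 => x; exact: cvg_fst.
apply: (@CkSI k _ (fun i _ => (basis R i).1)) => [x|i p|i].
- exact: cvg_fst.
- exact: is_derive_fst.
- exact: Ck_cst.
Qed.

Lemma Ck_snd k : Ck setT k (@snd R R).
Proof.
case: k => [|k]; first by apply: continuous_Ck0 => x; exact: cvg_snd.
apply: (@CkSI k _ (fun i _ => (basis R i).2)) => [x|i p|i].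
- exact: cvg_snd.
- exact: is_derive_snd.
- exact: Ck_cst.
Qed.

Lemma Ck_add k f g : Ck setT k f -> Ck setT k g ->
  Ck setT k (fun x => f x + g x).
Proof.
elim: k f g => [|k IH] f g fk gk.
  apply: continuous_Ck0 => x.
  by apply: cvgD; [exact: (Ck_continuous fk)|exact: (Ck_continuous gk)].
apply: (@CkSI k _ (fun i x => partial i f x + partial i g x)) => [x|i p|i].
- by apply: cvgD; [exact: (Ck_continuous fk)|exact: (Ck_continuous gk)].
- by apply: is_derive_add; [exact: CkS_is_derive fk|exact: CkS_is_derive gk].
- by apply: IH; [exact: CkS_partial fk|exact: CkS_partial gk].
Qed.

Lemma Ck_mul k f g : Ck setT k f -> Ck setT k g ->
  Ck setT k (fun x => f x * g x).
Proof.
elim: k f g => [|k IH] f g fk gk.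
  apply: continuous_Ck0 => x.
  by apply: cvgM; [exact: (Ck_continuous fk)|exact: (Ck_continuous gk)].
apply: (@CkSI k _ (fun i x => partial i f x * g x + f x * partial i g x))
  => [x|i p|i].
- by apply: cvgM; [exact: (Ck_continuous fk)|exact: (Ck_continuous gk)].
- by apply: is_derive_mul; [exact: CkS_is_derive fk|exact: CkS_is_derive gk].
- by apply: Ck_add; apply: IH;
    [exact: CkS_partial fk|exact: CkW|exact: CkW|exact: CkS_partial gk].
Qed.

Lemma Ck_opp k f : Ck setT k f -> Ck setT k (fun x => - f x).
Proof.
move=> fk; rewrite (_ : (fun x => - f x) = (fun x => -1 * f x)).
  by apply: Ck_mul => //; exact: Ck_cst.
by apply/funext => x; rewrite mulN1r.
Qed.

Lemma Ck_sub k f g : Ck setT k f -> Ck setT k g ->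
  Ck setT k (fun x => f x - g x).
Proof. by move=> fk gk; apply: Ck_add => //; exact: Ck_opp. Qed.

Lemma Ck_exp k f n : Ck setT k f -> Ck setT k (fun x => f x ^+ n).
Proof.
move=> fk; elim: n => [|n IH]; first exact: Ck_cst.
by under eq_fun do rewrite exprS; exact: Ck_mul.
Qed.

Lemma Ck_inv k f : (forall x, f x != 0) -> Ck setT k f ->
  Ck setT k (fun x => (f x)^-1).
Proof.
move=> f0; elim: k => [|k IH] fk.
  apply: continuous_Ck0 => x; apply: cvgV => //.
  exact: (Ck_continuous fk).
apply: (@CkSI k _ (fun i x => - partial i f x * ((f x)^-1 ^+ 2))) => [x|i p|i].
- by apply: cvgV => //; exact: (Ck_continuous fk).
- rewrite exprVn; apply: is_derive_inv => //; exact: CkS_is_derive fk.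
- apply: Ck_mul; first by apply: Ck_opp; exact: CkS_partial fk.
  by apply: Ck_exp; apply: IH; exact: CkW.
Qed.

Lemma Ck_sqrt k f : (forall x, 0 < f x) -> Ck setT k f ->
  Ck setT k (fun x => Num.sqrt (f x)).
Proof.
move=> f0; have c : Ck setT 0 f -> continuous (fun x => Num.sqrt (f x)).
  move=> fk x; apply: continuous_comp; first exact: (Ck_continuous fk).
  exact: sqrt_continuous.
elim: k => [|k IH] fk; first exact/continuous_Ck0/c.
apply: (@CkSI k _ (fun i x => partial i f x * (2 * Num.sqrt (f x))^-1))
  => [|i p|i].
- by apply: c; exact: Ck_le fk.
- by apply: is_derive_sqrt => //; exact: CkS_is_derive fk.
- apply: Ck_mul; first exact: CkS_partial fk.
  apply: Ck_inv => [x|]; first by rewrite mulf_neq0// gt_eqF// sqrtr_gt0.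
  by apply: Ck_mul; [exact: Ck_cst|apply: IH; exact: CkW].
Qed.

End CkCalculus.

(** * Smooth functions that are flat at the origin *)

Section Flat.
Variable R : realType.
Implicit Types (P : {poly R}) (x : R).

(** The polynomial factor makes the family stable under differentiation, so that smoothness to every
    order is a plain induction. *)
Definition flat P x : R := if 0 < x then P.[x^-1] * expR (- x^-1) else 0.

(** With y = 1 / x, the exponential series gives y^(i+1) <= (i+1)! e^y; applied to each monomial
    this gains a factor x. The linear bound is what controls difference quotients at 0. *)
Lemma flat_bound P : exists C, forall x, `|flat P x| <= C * `|x|.
Proof.
exists (\sum_(i < size P) `|P`_i| * i.+1`!%:R) => x; rewrite /flat.
have C0 : 0 <= \sum_(i < size P) `|P`_i| * i.+1`!%:R.
  by apply: sumr_ge0 => i _; rewrite mulr_ge0// ler0n.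
case: ltP => [x0|_]; last by rewrite normr0 mulr_ge0.
rewrite horner_coef mulr_suml mulr_suml (le_trans (ler_norm_sum _ _ _))//.
apply: ler_sum => i _.
rewrite -mulrA normrM -mulrA; apply: ler_wpM2l => //.
set y := x^-1; have y0 : 0 < y by rewrite invr_gt0.
rewrite gtr0_norm ?mulr_gt0 ?exprn_gt0 ?expR_gt0// gtr0_norm//.
rewrite expRN -[x]invrK -/y ler_pdivrMr ?expR_gt0// mulrAC ler_pdivlMr//.
rewrite -exprSr -ler_pdivrMl ?ltr0n ?fact_gt0// mulrC.
by apply: le_trans (expR_ge1Dxn i (ltW y0)); rewrite lerDr.
Qed.

Lemma flatX P x : flat ('X * P) x = x^-1 * flat P x.
Proof.
by rewrite /flat; case: ifP => _; rewrite ?mulr0// hornerM hornerX mulrA.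
Qed.

(** For x > 0 this is the chain rule for P(1/x) e^(-1/x). At 0 the difference quotient of [flat P]
    is [flat ('X * P)], which tends to 0 by [flat_bound]. *)
Lemma is_derive_flat P x :
  is_derive x 1 (flat P) (flat ('X^2 * (P - P^`())) x).
Proof.
have [x0|x0|->] := ltgtP x 0.
- rewrite {2}/flat ltNge (ltW x0) /=.
  apply: (@near_eq_is_derive _ _ _ (cst 0)).
  near=> y; rewrite /flat ltNge ltW//; near: y; exact: lt_nbhsl.
- rewrite {2}/flat x0.
  apply: (@near_eq_is_derive _ _ _ (fun y : R => P.[y^-1] * expR (- y^-1))).
    near=> y; rewrite /flat ifT//; near: y; exact: lt_nbhsr.
  have iV : is_derive x 1 (fun y : R => y^-1) (- 1 / x ^+ 2).
    by apply: is_derive_inv; rewrite gt_eqF.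
  have iP := is_derive_comp iV (is_derive_poly P (x^-1)).
  have iE := is_derive_comp (is_derive_opp iV) (is_derive_expR (- x^-1)).
  apply: is_derive_eq (is_derive_mul iP iE) _.
  rewrite hornerM hornerXn hornerD hornerN -exprVn.
  by field; rewrite gt_eqF.
- rewrite [X in is_derive _ _ _ X]/flat ltxx.
  have [C HC] := flat_bound ('X * P).
  have C0 : 0 <= C by have := HC 1; rewrite normr1 mulr1; exact: le_trans.
  apply: is_derive_cvg.
  have -> : (fun t : R => t^-1 * (flat P (t *: 1 + 0) - flat P 0)) =
            flat ('X * P).
    apply/funext => t; rewrite addr0 /GRing.scale /= mulr1.
    by rewrite [X in _ - X]/flat ltxx subr0 flatX.
  apply/cvgrPdist_lt => e e0; near=> t; rewrite sub0r normrN.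
  apply: le_lt_trans (HC t) _.
  apply: (@le_lt_trans _ _ ((C + 1) * `|t|)).
    by rewrite ler_wpM2r// lerDl.
  rewrite -ltr_pdivlMl ?ltr_wpDl//; near: t.
  apply: dnbhs0_lt; rewrite mulr_gt0// invr_gt0 ltr_wpDl//.
Unshelve. all: by end_near. Qed.

Lemma continuous_flat P : continuous (flat P).
Proof.
move=> x; apply: differentiable_continuous; apply/derivable1_diffP.
by case: (is_derive_flat P x).
Qed.

Lemma Ck_flat k P (f : R * R -> R) : Ck setT k f ->
  Ck setT k (fun q => flat P (f q)).
Proof.
elim: k P => [|k IH] Q fk.
  apply: continuous_Ck0 => q; apply: (@continuous_comp _ _ _ f (flat Q)).
    exact: (Ck_continuous fk).
  exact: continuous_flat.
apply: (@CkSI _ k _ (fun i q =>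
  flat ('X^2 * (Q - Q^`())) (f q) * partial i f q))
  => [q|i q|i].
- by apply: (@continuous_comp _ _ _ f (flat Q));
    [exact: (Ck_continuous fk)|exact: continuous_flat].
- by apply: is_derive_comp; [exact: CkS_is_derive fk|exact: is_derive_flat].
- apply: Ck_mul; last exact: CkS_partial fk.
  by apply: IH; exact: CkW.
Qed.

End Flat.

(** * Convergence in L^2 *)

Section SquareIntegrable.
Context d (T : measurableType d) (R : realType).
Variables (mu : {measure set T -> \bar R}) (D : set T).
Hypothesis mD : measurable D.
Implicit Types (f g h : T -> R).

(** Kept over a general measure space to serve both the disc and the circle; [L2] is its instance on
    the disc up to conversion. *)
Definition square_integrable f := measurable_fun D f /\
  (\int[mu]_(x in D) (f x ^+ 2)%:E < +oo)%E.

Definition cvg_L2 (F : nat -> T -> R) f :=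
  (\int[mu]_(x in D) ((F k x - f x) ^+ 2)%:E)%E @[k --> \oo] --> 0%E.

Lemma integrable_le f g : measurable_fun D f ->
  mu.-integrable D (EFin \o g) -> (forall x, D x -> `|f x| <= g x) ->
  mu.-integrable D (EFin \o f).
Proof.
move=> mf ig fg; apply: le_integrable ig => //; first exact/measurable_EFinP.
by move=> x Dx /=; rewrite lee_fin (le_trans (fg _ Dx))// ler_norm.
Qed.

Lemma integrable_mulM f g (M : R) : measurable_fun D f ->
  (forall x, D x -> `|f x| <= M) -> mu.-integrable D (EFin \o g) ->
  mu.-integrable D (EFin \o (fun x => f x * g x)).
Proof.
move=> mf fM ig.
have mg : measurable_fun D g by apply/measurable_EFinP; case/integrableP: ig.
have iM : mu.-integrable D (EFin \o (fun x => M * `|g x|)).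
  have := integrableZl mD M (integrable_norm ig); apply: eq_integrable => //.
apply: integrable_le iM _; first exact: measurable_funM.
by move=> x Dx; rewrite normrM ler_wpM2r// fM.
Qed.

Lemma ae_eq_Rintegral f g : measurable_fun D f -> measurable_fun D g ->
  ae_eq mu D f g -> \int[mu]_(x in D) f x = \int[mu]_(x in D) g x.
Proof.
move=> mf mg fg; rewrite /Rintegral; congr fine.
apply: ae_eq_integral => //; try exact/measurable_EFinP.
by apply: filterS fg => x H Dx; rewrite H.
Qed.

Lemma square_integrableP f : square_integrable f ->
  mu.-integrable D (EFin \o (fun x => f x ^+ 2)).
Proof.
move=> [mf fi]; apply/integrableP; split.
  by apply/measurable_EFinP; exact: measurable_funX.
apply: le_lt_trans fi; apply: ge0_le_integral => //.
- by apply/measurableT_comp => //; apply/measurable_EFinP; exact: measurable_funX.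
- by apply/measurable_EFinP; exact: measurable_funX.
- by move=> x _; rewrite lee_fin ger0_norm ?sqr_ge0.
Qed.

Lemma integrable_square f : measurable_fun D f ->
  mu.-integrable D (EFin \o (fun x => f x ^+ 2)) -> square_integrable f.
Proof.
move=> mf /integrableP[_ fi]; split=> //; apply: le_lt_trans fi.
apply: ge0_le_integral => //.
- by move=> x _; rewrite lee_fin sqr_ge0.
- by apply/measurable_EFinP; exact: measurable_funX.
- by apply/measurableT_comp => //; apply/measurable_EFinP; exact: measurable_funX.
- by move=> x _; rewrite lee_fin ler_norm.
Qed.

Lemma square_integrable_mul f g : square_integrable f -> square_integrable g ->
  mu.-integrable D (EFin \o (fun x => f x * g x)).
Proof.
move=> fi gi; have i2 := integrableD mD (square_integrableP fi) (square_integrableP gi).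
apply: (@integrable_le _ (fun x => f x ^+ 2 + g x ^+ 2)) => //.
  by apply: measurable_funM; [exact: fi.1|exact: gi.1].
move=> x _; rewrite ler_norml; apply/andP; split.
  by have := sqr_ge0 (f x + g x); have := sqr_ge0 (f x - g x); nra.
by have := sqr_ge0 (f x + g x); have := sqr_ge0 (f x - g x); nra.
Qed.

Lemma square_integrable_scale f (c : R) :
  square_integrable f -> square_integrable (fun x => c * f x).
Proof.
move=> fi; apply: integrable_square.
  by apply: measurable_funM; [exact: measurable_cst|exact: fi.1].
have := integrableZl mD (c ^+ 2) (square_integrableP fi).
by apply: eq_integrable => // x _ /=; rewrite exprMn EFinM.
Qed.

Lemma square_integrable_add f g : square_integrable f -> square_integrable g ->
  square_integrable (fun x => f x + g x).
Proof.
move=> fi gi.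
have mfg : measurable_fun D (fun x => f x + g x).
  by apply: measurable_funD; [exact: fi.1|exact: gi.1].
apply: integrable_square => //.
have := integrableD mD (square_integrableP (square_integrable_scale 2 fi))
  (square_integrableP (square_integrable_scale 2 gi)).
move=> i2; apply: (@integrable_le _ (fun x => (2 * f x) ^+ 2 + (2 * g x) ^+ 2)) => //.
  exact: measurable_funX.
move=> x _; rewrite ger0_norm ?sqr_ge0//.
by have := sqr_ge0 (f x + g x); have := sqr_ge0 (f x - g x); nra.
Qed.

Lemma square_integrable_sub f g : square_integrable f -> square_integrable g ->
  square_integrable (fun x => f x - g x).
Proof.
move=> fi /(square_integrable_scale (-1)) gi.
have := square_integrable_add fi gi.
by under eq_fun do rewrite mulN1r.
Qed.

Lemma square_integrable_mulM f g (M : R) : measurable_fun D f ->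
  (forall x, D x -> `|f x| <= M) -> square_integrable g ->
  square_integrable (fun x => f x * g x).
Proof.
move=> mf fM gi; apply: integrable_square.
  by apply: measurable_funM => //; exact: gi.1.
have -> : (fun x => (f x * g x) ^+ 2) = (fun x => f x ^+ 2 * g x ^+ 2).
  by apply/funext => x; rewrite exprMn.
apply: (@integrable_mulM _ _ (M ^+ 2)); last exact: square_integrableP.
  exact: measurable_funX.
by move=> x Dx; rewrite normrX ler_pXn2r ?nnegrE// ?(le_trans _ (fM _ Dx))// fM.
Qed.

Lemma square_integrable_bounded f (M : R) : (mu D < +oo)%E ->
  measurable_fun D f -> (forall x, D x -> `|f x| <= M) -> square_integrable f.
Proof.
move=> muD mf fM.
have -> : f = (fun x => f x * 1) by apply/funext => x; rewrite mulr1.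
apply: (@square_integrable_mulM _ _ M) => //; split => //.
by rewrite expr1n integral_cst// mul1e.
Qed.

Lemma Rintegral_square_eq0 f : square_integrable f ->
  \int[mu]_(x in D) (f x ^+ 2) = 0 -> ae_eq mu D f (cst 0).
Proof.
move=> fi f0.
have mf2 : measurable_fun D (fun x => (f x ^+ 2)%:E).
  by apply/measurable_EFinP; apply: measurable_funX; exact: fi.1.
have : (\int[mu]_(x in D) `|(f x ^+ 2)%:E| = 0)%E.
  have -> : (\int[mu]_(x in D) `|(f x ^+ 2)%:E| = \int[mu]_(x in D) (f x ^+ 2)%:E)%E.
    by apply: eq_integral => x _; rewrite gee0_abs// lee_fin sqr_ge0.
  have := integrable_fin_num mD (square_integrableP fi).
  by move/fineK => <-; rewrite -[X in X%:E]/(Rintegral _ _ _) f0.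
move/(ae_eq_integral_abs mu mD mf2).1; apply: filterS => x H Dx.
by have [] := H Dx; move/eqP; rewrite sqrf_eq0 => /eqP.
Qed.

Lemma cvg_L2_Rintegral F f : cvg_L2 F f ->
  \int[mu]_(x in D) ((F k x - f x) ^+ 2) @[k --> \oo] --> (0 : R).
Proof. by move=> /fine_cvgP[]. Qed.

(** Weighted Young inequalities |s t| <= (e s^2 + t^2 / e) / 2 replace Cauchy-Schwarz. They bound
    the error by a multiple of (1 + 1/e)(A k + B k) + e (a + b), where [A] and [B] tend to 0; [e] is
    fixed first, then [k]. *)
Lemma cvg_L2_mul F G f g h (M : R) :
  (forall k, square_integrable (F k)) -> (forall k, square_integrable (G k)) ->
  square_integrable f -> square_integrable g ->
  measurable_fun D h -> (forall x, D x -> `|h x| <= M) ->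
  cvg_L2 F f -> cvg_L2 G g ->
  \int[mu]_(x in D) (h x * (F k x * G k x)) @[k --> \oo] -->
  \int[mu]_(x in D) (h x * (f x * g x)).
Proof.
move=> Fi Gi fi gi mh hM Ff Gg.
(* On an empty [D] the bound [M] may be negative, so it is replaced by a nonnegative one. *)
have M0 : 0 <= `|M| + 1 by rewrite addr_ge0.
have {}hM x : D x -> `|h x| <= `|M| + 1.
  by move=> /hM hM'; rewrite (le_trans hM')// (le_trans (ler_norm _))// lerDl.
move: (`|M| + 1) M0 hM => {}M M0 hM.
have Ai k : square_integrable (fun x => F k x - f x) by exact: square_integrable_sub.
have Bi k : square_integrable (fun x => G k x - g x) by exact: square_integrable_sub.
set A := fun k => \int[mu]_(x in D) ((F k x - f x) ^+ 2).
set B := fun k => \int[mu]_(x in D) ((G k x - g x) ^+ 2).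
have A0 : A k @[k --> \oo] --> (0 : R) by exact: cvg_L2_Rintegral.
have B0 : B k @[k --> \oo] --> (0 : R) by exact: cvg_L2_Rintegral.
set a := \int[mu]_(x in D) (f x ^+ 2); set b := \int[mu]_(x in D) (g x ^+ 2).
have a0 : 0 <= a by apply: Rintegral_ge0 => x _; exact: sqr_ge0.
have b0 : 0 <= b by apply: Rintegral_ge0 => x _; exact: sqr_ge0.
have key k (e : R) : 0 < e ->
  `|\int[mu]_(x in D) (h x * (f x * g x)) -
    \int[mu]_(x in D) (h x * (F k x * G k x))| <=
  M * ((1 + e^-1) * (A k + B k) + e * (a + b)).
  move=> e0.
  have ihfg : mu.-integrable D (EFin \o (fun x => h x * (f x * g x))).
    by apply: integrable_mulM hM _ => //; exact: square_integrable_mul.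
  have ihFG : mu.-integrable D (EFin \o (fun x => h x * (F k x * G k x))).
    by apply: integrable_mulM hM _ => //; exact: square_integrable_mul.
  have iA := square_integrableP (Ai k).
  have iB := square_integrableP (Bi k).
  have ia := square_integrableP fi.
  have ib := square_integrableP gi.
  have iAB := integrableD mD iA iB.
  have iab := integrableD mD ia ib.
  have iAB' := integrableZl mD (1 + e^-1) iAB.
  have iab' := integrableZl mD e iab.
  have iS := integrableD mD iAB' iab'.
  have iM := integrableZl mD M iS.
  rewrite -RintegralB//.
  have iB' := integrableB mD ihfg ihFG.
  apply: le_trans (le_normr_Rintegral mD iB') _.
  have -> : M * ((1 + e^-1) * (A k + B k) + e * (a + b)) =
    \int[mu]_(x in D) (M * ((1 + e^-1) * ((F k x - f x) ^+ 2 + (G k x - g x) ^+ 2)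
      + e * (f x ^+ 2 + g x ^+ 2))).
    by rewrite RintegralZl// RintegralD// !RintegralZl// !RintegralD//.
  apply: le_Rintegral => //; first exact: integrable_norm.
  move=> x Dx; rewrite -mulrBr normrM.
  apply: ler_pM => //; first exact: hM.
  set p := F k x; set q := G k x.
  have e2 : e * e^-1 = 1 by rewrite divff// gt_eqF.
  have ei : 0 < e^-1 by rewrite invr_gt0.
  have AM (s t : R) : `|s * t| <= (e * s ^+ 2 + e^-1 * t ^+ 2) / 2.
    rewrite ler_norml; apply/andP; split.
      have := mulr_ge0 (ltW ei) (sqr_ge0 (e * s + t)).
      have -> : e^-1 * (e * s + t) ^+ 2 =
        e * (e * e^-1) * s ^+ 2 + 2 * (e * e^-1) * (s * t) + e^-1 * t ^+ 2 by ring.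
      by rewrite e2; lra.
    have := mulr_ge0 (ltW ei) (sqr_ge0 (e * s - t)).
    have -> : e^-1 * (e * s - t) ^+ 2 =
      e * (e * e^-1) * s ^+ 2 - 2 * (e * e^-1) * (s * t) + e^-1 * t ^+ 2 by ring.
    by rewrite e2; lra.
  have -> : f x * g x - p * q =
     - ((p - f x) * (q - g x)) - f x * (q - g x) - g x * (p - f x) by ring.
  apply: le_trans (ler_normB _ _) _.
  apply: le_trans (lerD (ler_normB _ _) (lexx _)) _.
  rewrite normrN.
  have := AM (f x) (q - g x); have := AM (g x) (p - f x).
  have : `|(p - f x) * (q - g x)| <= ((p - f x) ^+ 2 + (q - g x) ^+ 2) / 2.
    rewrite ler_norml; apply/andP; split.
      by have := sqr_ge0 (p - f x + (q - g x)); lra.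
    by have := sqr_ge0 (p - f x - (q - g x)); lra.
  have := mulr_ge0 (ltW ei) (sqr_ge0 (p - f x)).
  have := mulr_ge0 (ltW ei) (sqr_ge0 (q - g x)).
  have := mulr_ge0 (ltW e0) (sqr_ge0 (f x)).
  have := mulr_ge0 (ltW e0) (sqr_ge0 (g x)).
  have := sqr_ge0 (p - f x).
  have := sqr_ge0 (q - g x).
  by rewrite [(1 + e^-1) * _]mulrDl mul1r !mulrDr; lra.
apply/cvgrPdist_lt => e e0.
(* The added units keep [c] positive when [a] and [b] vanish; then t * c = e / 2 dominates M * t *
   (a + b). *)
pose c := (M + 1) * (a + b + 1).
have c0 : 0 < c by rewrite mulr_gt0// ltr_wpDl// addr_ge0.
pose t := e / 2 / c.
have t0 : 0 < t by rewrite !divr_gt0.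
have cvgAB : M * ((1 + t^-1) * (A k + B k)) @[k --> \oo] --> (0 : R).
  rewrite -[X in _ --> X](mulr0 M); apply: cvgMr.
  rewrite -[X in _ --> X](mulr0 (1 + t^-1)); apply: cvgMr.
  by rewrite -[X in _ --> X](addr0 0); exact: cvgD.
have e20 : 0 < e / 2 by rewrite divr_gt0.
move/cvgrPdist_lt : cvgAB => /(_ _ e20).
apply: filterS => k; rewrite sub0r normrN => Hk.
apply: le_lt_trans (key k _ t0) _; rewrite mulrDr.
have -> : e = e / 2 + e / 2 by lra.
apply: ltr_leD; first by apply: le_lt_trans Hk; exact: ler_norm.
have -> : e / 2 = t * c by rewrite /t divfK// gt_eqF.
rewrite mulrCA ler_pM2l// /c; nra.
Qed.

Lemma cvg_L2_cst f : cvg_L2 (fun=> f) f.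
Proof.
rewrite /cvg_L2; under eq_fun do under eq_integral do rewrite subrr expr0n.
by rewrite integral0; exact: cvg_cst.
Qed.

Lemma cvg_L2_sub F G f g :
  (forall k, square_integrable (F k)) -> (forall k, square_integrable (G k)) ->
  square_integrable f -> square_integrable g -> cvg_L2 F f -> cvg_L2 G g ->
  cvg_L2 (fun k x => F k x - G k x) (fun x => f x - g x).
Proof.
move=> Fi Gi fi gi Ff Gg.
have Ai k : square_integrable (fun x => F k x - f x) by exact: square_integrable_sub.
have Bi k : square_integrable (fun x => G k x - g x) by exact: square_integrable_sub.
have H : (2%:E * (\int[mu]_(x in D) ((F k x - f x) ^+ 2)%:E +
   \int[mu]_(x in D) ((G k x - g x) ^+ 2)%:E))%E @[k --> \oo] --> 0%E.
  rewrite -[X in _ --> X](mule0 2%:E); apply: cvgeMl => //.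
  by rewrite -[X in _ --> X](adde0 0%E); exact: cvgeD.
apply: squeeze_cvge H; last exact: (@cvg_cst _ 0%E).
apply: nearW => k; apply/andP; split.
  by apply: integral_ge0 => x _; rewrite lee_fin sqr_ge0.
rewrite -ge0_integralD//; first last.
- by apply/measurable_EFinP; apply: measurable_funX; exact: (Bi k).1.
- by move=> x _; rewrite lee_fin sqr_ge0.
- by apply/measurable_EFinP; apply: measurable_funX; exact: (Ai k).1.
- by move=> x _; rewrite lee_fin sqr_ge0.
rewrite -ge0_integralZl//; first last.
- by move=> x _; rewrite adde_ge0// lee_fin sqr_ge0.
- by apply: emeasurable_funD; apply/measurable_EFinP; apply: measurable_funX;
    [exact: (Ai k).1|exact: (Bi k).1].
apply: ge0_le_integral => //.
- by move=> x _; rewrite lee_fin sqr_ge0.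
- apply/measurable_EFinP; apply: measurable_funX.
  by apply: measurable_funB; apply: measurable_funB;
    [exact: (Fi k).1|exact: (Gi k).1|exact: fi.1|exact: gi.1].
- apply/measurable_EFinP; apply: measurable_funM => //.
  by apply: measurable_funD; apply: measurable_funX;
    [exact: (Ai k).1|exact: (Bi k).1].
move=> x _; rewrite -EFinD -EFinM lee_fin.
have := sqr_ge0 ((F k x - f x) + (G k x - g x)).
by lra.
Qed.

End SquareIntegrable.

(** * The divergence theorem on the disc *)

Section PlaneMeasurability.
Variable R : realType.

(** An open set is the union of the rational boxes that it contains: balls of the sup norm are
    boxes, and the rational boxes are countable. *)
Lemma open_measurable_prod (A : set (R * R)) : open A ->
  measurable (A : set (measurableTypeR R * measurableTypeR R)).
Proof.
move=> oA.
pose B (q : (rat * rat) * (rat * rat)) : set (R * R) :=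
  `]ratr q.1.1, ratr q.1.2[%classic `*` `]ratr q.2.1, ratr q.2.2[%classic.
have -> : A = \bigcup_q (if `[< B q `<=` A >] then B q else set0).
  apply/seteqP; split => [p Ap|p [q _]]; last first.
    by case: asboolP => // BA; exact: BA.
  have [e /= e0 eA] := (nbhs_ballP p A).1 (oA p Ap).
  have q1 : p.1 - e < p.1 by lra.
  have q2 : p.1 < p.1 + e by lra.
  have q3 : p.2 - e < p.2 by lra.
  have q4 : p.2 < p.2 + e by lra.
  have [a /[!in_itv]/= /andP[a1 a2]] := rat_in_itvoo q1.
  have [b /[!in_itv]/= /andP[b1 b2]] := rat_in_itvoo q2.
  have [c /[!in_itv]/= /andP[c1 c2]] := rat_in_itvoo q3.
  have [d /[!in_itv]/= /andP[d1 d2]] := rat_in_itvoo q4.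
  exists ((a, b), (c, d)) => //; case: asboolP => [_|[]].
    by rewrite /B; split; rewrite /= in_itv/=; apply/andP; split.
  move=> x [/= /[!in_itv]/= /andP[x1 x2] /andP[x3 x4]]; apply: eA.
  by split; rewrite /ball /= ltr_norml; apply/andP; split; lra.
apply: countable_bigcupT_measurable => // q; case: asboolP => // _.
by apply: measurableX.
Qed.

Lemma continuous_measurable_prod (f : R * R -> R) : continuous f ->
  measurable_fun [set: measurableTypeR R * measurableTypeR R]
    (f : _ -> measurableTypeR R).
Proof.
move=> /continuousP cf; apply: (measurability _ (RGenOpens.measurableE R)).
move=> _ [_ [a [b ->] <-]]; rewrite setTI; apply: open_measurable_prod.
exact/cf/interval_open.
Qed.

Lemma continuous_enorm : continuous (@enorm R).
Proof.
move=> p; apply: continuous_comp; last exact: sqrt_continuous.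
by apply: cvgD; rewrite expr2; apply: cvgM; (exact: cvg_fst || exact: cvg_snd).
Qed.

Lemma open_disc : open (disc R).
Proof.
rewrite (_ : disc R = @enorm R @^-1` [set x | x < 1])//.
apply: open_comp; last exact: open_lt.
by move=> x _; exact: continuous_enorm.
Qed.

Lemma measurable_disc :
  measurable (disc R : set (measurableTypeR R * measurableTypeR R)).
Proof. by apply: open_measurable_prod; exact: open_disc. Qed.

Lemma discP (p : R * R) : disc R p <-> p.1 ^+ 2 + p.2 ^+ 2 < 1.
Proof.
suff -> : disc R p = (p.1 ^+ 2 + p.2 ^+ 2 < 1) :> Prop by [].
by rewrite /disc /= /enorm -[X in _ < X]sqrtr1 ltr_sqrt.
Qed.

Lemma leb2_disc_lty : (leb2 R (disc R) < +oo)%E.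
Proof.
have sub : disc R `<=` `[-1, 1]%classic `*` `[-1, 1]%classic.
  move=> [x y] /discP /= xy; split; rewrite /= in_itv/=; apply/andP;
  by split; have := sqr_ge0 x; have := sqr_ge0 y; nra.
apply: (@le_lt_trans _ _ (leb2 R (`[-1, 1]%classic `*` `[-1, 1]%classic))).
  apply: le_measure => //; rewrite inE; first exact: measurable_disc.
  exact: measurableX.
rewrite /leb2 product_measure1E//= lebesgue_measure_itv/=.
by rewrite lte_fin (_ : -1 < 1) ?ltry//; lra.
Qed.

(** The bound holds on the closed disc, so that the same constant serves on the boundary circle. *)
Lemma continuous_bounded_disc (f : R * R -> R) : continuous f ->
  exists M, forall x, enorm x <= 1 -> `|f x| <= M.
Proof.
move=> cf.
have cK : compact (`[(-1) : R, 1] `*` `[(-1) : R, 1]).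
  by apply: compact_setX; exact: segment_compact.
have cf' : {within `[(-1) : R, 1] `*` `[(-1) : R, 1], continuous f}.
  exact: continuous_subspaceT.
have /compact_bounded[M [_ mrt]] := continuous_compact cf' cK.
exists (`|M| + 1) => -[x y] xy.
apply: (mrt (`|M| + 1)); first by rewrite ltr_pwDr// ler_norm.
exists (x, y) => //.
have {}xy : x ^+ 2 + y ^+ 2 <= 1.
  by move: xy; rewrite /enorm -[X in _ <= X]sqrtr1 ler_sqrt.
by split; rewrite /= in_itv/=; apply/andP;
  split; have := sqr_ge0 x; have := sqr_ge0 y; nra.
Qed.

End PlaneMeasurability.

(** * Integrals of continuous functions over intervals and over the circle *)

Section ContinuousIntegrals.
Variable R : realType.
Notation mu := (@lebesgue_measure R).
Implicit Types (g G : R -> R) (a b c : R).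

Lemma integrable_continuous g a b : continuous g ->
  mu.-integrable `[a, b] (EFin \o g).
Proof.
move=> cg; apply: continuous_compact_integrable; first exact: segment_compact.
exact: continuous_subspaceT.
Qed.

Lemma Rintegral_itv_cat g a b c : continuous g -> a <= b -> b <= c ->
  \int[mu]_(x in `[a, c]) g x =
  \int[mu]_(x in `[a, b]) g x + \int[mu]_(x in `[b, c]) g x.
Proof.
move=> cg ab bc; have := integrable_continuous a c cg.
move=> /(Rintegral_itvB (x := b)); rewrite !bnd_simp => /(_ ab bc).
rewrite Rintegral_itv_obnd_cbnd; first by move=> <-; rewrite addrC subrK.
apply: integrableS (integrable_continuous b c cg) => //.
by apply: subset_itv; rewrite bnd_simp.
Qed.

Lemma Rintegral_FTC g G a b : continuous g ->
  (forall x : R, is_derive x 1 G (g x)) -> a <= b ->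
  \int[mu]_(x in `[a, b]) g x = G b - G a.
Proof.
move=> cg dG; rewrite le_eqVlt => /predU1P[<-|ab].
  by rewrite set_itv1 Rintegral_set1 subrr.
have cG : continuous G.
  move=> x; apply: differentiable_continuous; apply/derivable1_diffP.
  by case: (dG x).
rewrite /Rintegral (@continuous_FTC2 _ _ G)//.
- exact: continuous_subspaceT.
- split.
  + by move=> x _; case: (dG x).
  + exact/cvg_at_right_filter/cG.
  + exact/cvg_at_left_filter/cG.
- by move=> x _; rewrite derive1E; case: (dG x).
Qed.

Lemma Rintegral_oppr g a b : continuous g -> a <= b ->
  \int[mu]_(x in `[- b, - a]) g x = \int[mu]_(x in `[a, b]) g (- x).
Proof.
move=> cg ab; rewrite /Rintegral integration_by_substitution_oppr//.
exact: continuous_subspaceT.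
Qed.

Lemma Rintegral_shift g a b c : continuous g -> a <= b ->
  \int[mu]_(x in `[a + c, b + c]) g x = \int[mu]_(x in `[a, b]) g (x + c).
Proof.
move=> cg ab.
have dF : derive1 (fun x : R => x + c) = cst 1.
  by apply/funext => z; rewrite derive1E derive_val addr0.
rewrite /Rintegral.
rewrite (@integration_by_substitution_increasing _ (fun x => x + c) g a b)//.
- by congr fine; apply: eq_integral => x _; rewrite dF /= !fctE mulr1.
- by move=> x y _ _; rewrite ltrD2r.
- by rewrite dF => ? _; exact: cvg_cst.
- by rewrite dF; exact: is_cvg_cst.
- by rewrite dF; exact: is_cvg_cst.
- split => //.
  + by apply: cvg_at_right_filter; apply: cvgD => //; exact: cvg_cst.
  + by apply: cvg_at_left_filter; apply: cvgD => //; exact: cvg_cst.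
- exact: continuous_subspaceT.
Qed.

Lemma Rintegral_cos g : continuous g ->
  \int[mu]_(x in `[-1, 1]) g x = \int[mu]_(t in `[0, pi]) (g (cos t) * sin t).
Proof.
move=> cg.
have dF : derive1 (@cos R) = (fun t => - sin t).
  by apply/funext => z; rewrite derive1E derive_val.
have cs : continuous (fun t : R => - sin t).
  by move=> t; apply: cvgN; exact: continuous_sin.
have := @integration_by_substitution_decreasing _ (@cos R) g 0 pi (pi_ge0 R).
rewrite cospi cos0 /Rintegral => ->.
- by congr fine; apply: eq_integral => x _; rewrite dF /= !fctE opprK.
- by move=> x y x0 y0; rewrite ltr_cos.
- by rewrite dF => ? _; exact: cs.
- rewrite dF; apply/cvg_ex; exists (- sin 0).
  exact/cvg_at_right_filter/cs.
- rewrite dF; apply/cvg_ex; exists (- sin pi).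
  exact/cvg_at_left_filter/cs.
- split => //.
  + exact/cvg_at_right_filter/continuous_cos.
  + exact/cvg_at_left_filter/continuous_cos.
- exact: continuous_subspaceT.
Qed.

Lemma continuous_pair (T : topologicalType) (f g : T -> R) (K : R * R -> R) :
  continuous f -> continuous g -> continuous K ->
  continuous (fun t => K (f t, g t)).
Proof.
move=> cf cg cK t.
have := @cvg_comp2 T R R R (nbhs t) (nbhs (f t)) (nbhs (g t))
  (nbhs (K (f t, g t))) _ _ _ f g (fun a b => K (a, b)) (cf t) (cg t).
apply; have -> : (fun x : R * R => K (x.1, x.2)) = K by apply/funext => -[].
exact: (cK (f t, g t)).
Qed.

Lemma continuous_half_circle : continuous (fun x : R => Num.sqrt (1 - x ^+ 2)).
Proof.
move=> x.
apply: (@continuous_comp _ _ _ (fun x : R => 1 - x ^+ 2) Num.sqrt).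
  by apply: cvgB; [exact: cvg_cst|exact: exprn_continuous].
exact: sqrt_continuous.
Qed.

(** Under x = cos t with t in [0, pi], sqrt (1 - x^2) is sin t on the upper half circle. The
    subtracted term is the lower half circle seen through t |-> - t, whose sign is absorbed by sin
    (- t). *)
Lemma Rintegral_arc (K : R * R -> R) : continuous K ->
  \int[mu]_(x in `[-1, 1])
     (K (x, Num.sqrt (1 - x ^+ 2)) - K (x, - Num.sqrt (1 - x ^+ 2))) =
  \int[mu]_(t in `[- pi, pi]) (K (cos t, sin t) * sin t).
Proof.
move=> cK.
have ci : continuous (fun x : R => x) by move=> x; exact: cvg_id.
have ch := continuous_half_circle.
have chN : continuous (fun x : R => - Num.sqrt (1 - x ^+ 2)).
  by move=> x; apply: cvgN; exact: ch.
have cP : continuous (fun t => K (cos t, sin t) * sin t).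
  move=> t; apply: cvgM; last exact: continuous_sin.
  exact: (continuous_pair (@continuous_cos R) (@continuous_sin R) cK).
rewrite Rintegral_cos; last first.
  move=> x; apply: cvgB; first exact: (continuous_pair ci ch cK).
  exact: (continuous_pair ci chN cK).
rewrite (@Rintegral_itv_cat _ (- pi) 0 pi)//; [|by rewrite oppr_le0 pi_ge0|exact: pi_ge0].
rewrite -{2}oppr0 Rintegral_oppr//; last exact: pi_ge0.
have cPN : continuous (fun t => K (cos (- t), sin (- t)) * sin (- t)).
  move=> t; apply: (@continuous_comp _ _ _ -%R (fun t => K (cos t, sin t) * sin t)).
    exact: opp_continuous.
  exact: cP.
rewrite -RintegralD//; [|exact: integrable_continuous..].
apply: eq_Rintegral => t; rewrite inE /= in_itv /= => t0.
rewrite cosN sinN -sin2cos2 sqrtr_sqr ger0_norm ?sin_ge0_pi//.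
by ring.
Qed.

(** The map t |-> pi / 2 - t is the reflection of the circle in the diagonal; this invariance
    carries the divergence theorem from one coordinate direction to the other. The reflected
    interval overshoots by a quarter turn, which is moved back by one period. *)
Lemma Rintegral_period g : continuous g -> (forall t, g (t + pi *+ 2) = g t) ->
  \int[mu]_(t in `[- pi, pi]) g (pi / 2 - t) = \int[mu]_(t in `[- pi, pi]) g t.
Proof.
move=> cg pg; have p0 := pi_gt0 R.
have cs (c : R) : continuous (fun t => g (c + t)).
  move=> t; apply: (@continuous_comp _ _ _ (fun t => c + t) g); last exact: cg.
  by apply: cvgD => //; exact: cvg_cst.
have csN : continuous (fun t => g (pi / 2 - t)).
  move=> t; apply: (@continuous_comp _ _ _ -%R (fun t => g (pi / 2 + t))).
    exact: opp_continuous.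
  exact: cs.
have -> : \int[mu]_(t in `[- pi, pi]) g (pi / 2 - t) =
          \int[mu]_(t in `[- pi, pi]) g (pi / 2 + t).
  rewrite -{1}[X in `[_, X]]opprK Rintegral_oppr//; last lra.
  by apply: eq_Rintegral => t _; rewrite opprK.
have -> : \int[mu]_(t in `[- pi, pi]) g (pi / 2 + t) =
          \int[mu]_(t in `[- pi + pi / 2, pi + pi / 2]) g t.
  rewrite Rintegral_shift//; last lra.
  by apply: eq_Rintegral => t _; rewrite addrC.
rewrite (@Rintegral_itv_cat _ _ pi)//; [|lra|lra].
rewrite (@Rintegral_itv_cat _ (- pi) (- pi + pi / 2) pi)//; [|lra|lra].
rewrite addrC; congr (_ + _).
have e1 : - pi + pi *+ 2 = pi :> R by ring.
have e2 : - pi + pi / 2 + pi *+ 2 = pi + pi / 2 :> R by ring.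
have := @Rintegral_shift g (- pi) (- pi + pi / 2) (pi *+ 2) cg.
rewrite e1 e2 => ->; last lra.
by apply: eq_Rintegral => t _.
Qed.

End ContinuousIntegrals.

(** * Iterated integrals on the disc *)

Section DiscFubini.
Variable R : realType.
Notation mu := (@lebesgue_measure R).
Implicit Types h : R * R -> R.

Lemma integrable_disc_continuous h : continuous h ->
  (leb2 R).-integrable (disc R) (EFin \o h).
Proof.
move=> ch; apply: measurable_bounded_integrable.
- exact: measurable_disc.
- exact: leb2_disc_lty.
- apply: measurable_funS (continuous_measurable_prod ch) => //.
- have [M HM] := continuous_bounded_disc ch.
  exists M; split; first exact: num_real.
  by move=> x Mx p dp /=; apply: le_trans (HM _ (ltW dp)) (ltW Mx).
Qed.

Lemma Rintegral_disc h : continuous h ->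
  \int[leb2 R]_(p in disc R) h p =
  \int[mu]_(x in `[-1, 1])
    \int[mu]_(y in `[- Num.sqrt (1 - x ^+ 2), Num.sqrt (1 - x ^+ 2)]) h (x, y).
Proof.
move=> ch; have mD := @measurable_disc R.
have ih : (leb2 R).-integrable setT ((EFin \o h) \_ (disc R)).
  exact: (integrable_mkcond _ mD).1 (integrable_disc_continuous ch).
rewrite /Rintegral; congr fine.
rewrite integral_mkcond -(integral12_prod_meas1 ih) [RHS]integral_mkcond.
apply: eq_integral => x _; rewrite /fubini_F patchE.
set s := Num.sqrt (1 - x ^+ 2).
have cx : continuous (fun y => h (x, y)).
  by apply: (@continuous_pair _ _ (fun=> x) (fun y => y) h) => // y;
    [exact: cvg_cst|exact: cvg_id].
have s0 : 0 <= s by exact: sqrtr_ge0.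
case: ifPn => [|]; rewrite ?notin_setE ?inE /= in_itv /=.
  move=> /andP[x1 x2].
  have s2 : s ^+ 2 = 1 - x ^+ 2 by rewrite sqr_sqrtr//; nra.
  rewrite fineK; last first.
    by apply: integrable_fin_num => //; exact: integrable_continuous.
  have mh (I : set R) : measurable I -> measurable_fun I (fun y => (h (x, y))%:E).
    move=> mI; apply/measurable_EFinP.
    by apply: measurable_funS (continuous_measurable_fun cx).
  (* A vertical section of the open disc is an open interval; its endpoints are null and are removed
     here. At |x| = 1 the closed interval is a point and the section is empty. *)
  rewrite -integral_itv_bndo_bndc; last exact: mh.
  rewrite -integral_itv_obnd_cbnd; last exact: mh.
  rewrite [RHS]integral_mkcond; apply: eq_integral => y _.
  rewrite !patchE /=; congr (if _ then _ else _).
  apply/idP/idP; rewrite !inE /= in_itv /= discP /= => H.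
    by apply/andP; split; nra.
  by case/andP: H => H1 H2; nra.
move=> xN; apply: integral0_eq => y _; rewrite patchE ifF//.
apply/negbTE; rewrite notin_setE discP /= => H.
by case: xN; apply/andP; split; have := sqr_ge0 y; nra.
Qed.

Lemma Rintegral_disc_swap h : continuous h ->
  \int[leb2 R]_(p in disc R) h p = \int[leb2 R]_(p in disc R) h (p.2, p.1).
Proof.
move=> ch; have mD := @measurable_disc R.
have ch' : continuous (fun p => h (p.2, p.1)).
  by apply: (@continuous_pair _ _ snd fst h) => // p; [exact: cvg_snd|exact: cvg_fst].
have ih : (leb2 R).-integrable setT ((EFin \o h) \_ (disc R)).
  exact: (integrable_mkcond _ mD).1 (integrable_disc_continuous ch).
have ih' : (leb2 R).-integrable setT ((EFin \o fun p => h (p.2, p.1)) \_ (disc R)).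
  exact: (integrable_mkcond _ mD).1 (integrable_disc_continuous ch').
rewrite /Rintegral; congr fine; rewrite integral_mkcond [RHS]integral_mkcond.
rewrite -(integral12_prod_meas1 ih) -(integral21_prod_meas1 ih').
apply: eq_integral => x _; apply: eq_integral => y _; rewrite !patchE /=.
congr (if _ then _ else _).
by apply/idP/idP; rewrite !inE !discP /= addrC.
Qed.

End DiscFubini.

(** * Integration by parts on the disc *)

Section Divergence.
Variable R : realType.
Notation mu := (@lebesgue_measure R).

Definition circle_normal (i : bool) (t : R) : R := if i then sin t else cos t.

(** On each vertical chord the fundamental theorem of calculus leaves the values of [f] at the two
    endpoints, and [Rintegral_arc] collects them into an integral over the circle. *)
Lemma Rintegral_disc_derive_snd (f g : R * R -> R) :
  continuous f -> continuous g ->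
  (forall p : R * R, is_derive p (0, 1) f (g p)) ->
  \int[leb2 R]_(p in disc R) g p =
  \int[mu]_(t in `[- pi, pi]) (f (cos t, sin t) * sin t).
Proof.
move=> cf cg dfg; rewrite Rintegral_disc// -Rintegral_arc//.
apply: eq_Rintegral => x _.
have ci : continuous (fun x : R => x) by move=> y; exact: cvg_id.
have cc : continuous (fun _ : R => x) by move=> y; exact: cvg_cst.
have H (y : R) : is_derive y 1 (fun y => f (x, y)) (g (x, y)).
  have [] := dfg (x, y); rewrite /derivable /derive => dc dl.
  have E : (fun h : R => h^-1 *: (f (h *: (0, 1) + (x, y)) - f (x, y))) =
           (fun h : R => h^-1 *: (f (x, h *: 1 + y) - f (x, y))).
    apply/funext => h; congr (_ *: (f _ - _)).
    by rewrite -[LHS]/(h *: (0 : R) + x, h *: (1 : R) + y) scaler0 add0r.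
  apply: DeriveDef.
    by rewrite /derivable -[X in cvg (X @ _)]E.
  by rewrite /derive -[X in lim (X @ _)]E.
apply: (Rintegral_FTC (continuous_pair cc ci cg) H).
by have := sqrtr_ge0 (1 - x ^+ 2); lra.
Qed.

(** The vertical direction is the preceding lemma. The horizontal one follows by exchanging the
    coordinates, which acts on the circle as t |-> pi / 2 - t. *)
Lemma divergence_disc (f : R * R -> R) i : Ck setT 1 f ->
  \int[leb2 R]_(p in disc R) partial i f p =
  \int[mu]_(t in `[- pi, pi]) (f (circle_pt t) * circle_normal i t).
Proof.
move=> f1; have cf := Ck_continuous f1.
have cp := Ck_continuous (CkS_partial i f1).
have df p := CkS_is_derive i p f1.
case: i cp df => cp df.
  exact: Rintegral_disc_derive_snd.
rewrite Rintegral_disc_swap//.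
have csw (h : R * R -> R) : continuous h -> continuous (fun p : R * R => h (p.2, p.1)).
  by move=> ch; apply: (@continuous_pair _ _ snd fst h) => // p;
    [exact: cvg_snd|exact: cvg_fst].
have H (p : R * R) :
    is_derive p (0, 1) (fun p => f (p.2, p.1)) (partial false f (p.2, p.1)).
  case: p => x y; have [] := df (y, x); rewrite /derivable /derive => dc dl.
  have E : (fun h : R => h^-1 *: (f (h *: (1, 0) + (y, x)) - f (y, x))) =
           (fun h : R => h^-1 *: (f ((h *: (0, 1) + (x, y)).2,
              (h *: (0, 1) + (x, y)).1) - f (y, x))) by apply/funext.
  apply: DeriveDef.
    by rewrite /derivable -[X in cvg (X @ _)]E.
  by rewrite /derive -[X in lim (X @ _)]E.
rewrite (Rintegral_disc_derive_snd (csw _ cf) (csw _ cp) H).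
rewrite /circle_normal.
pose P t := f (cos t, sin t) * cos t.
have cP : continuous P.
  move=> t; apply: cvgM; last exact: continuous_cos.
  exact: (continuous_pair (@continuous_cos R) (@continuous_sin R) cf).
rewrite -[RHS](@Rintegral_period _ P)//; last first.
  by move=> t; rewrite /P cosD2pi sinD2pi.
apply: eq_Rintegral => t _.
by rewrite /P cosB sinB cos_pihalf sin_pihalf /= !mul0r !mul1r !add0r subr0.
Qed.

End Divergence.

(** * Uniqueness of weak derivatives *)

Section FundamentalLemma.
Variable R : realType.
Let RR := (measurableTypeR R * measurableTypeR R)%type.

(** Quadrants are stable under intersection, generate the Borel sets, and have indicators that are
    limits of products of smooth one-variable functions. *)
Definition quadrant (a c : R) : set (R * R) := [set p | a < p.1 /\ c < p.2].

Lemma measurable_quadrant a c : measurable (quadrant a c : set RR).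
Proof.
apply: open_measurable_prod; rewrite (_ : quadrant a c =
  (fst @^-1` [set x | a < x]) `&` (snd @^-1` [set x | c < x]))//.
by apply: openI; apply: open_comp; try exact: open_gt;
  move=> x _; [exact: cvg_fst|exact: cvg_snd].
Qed.

(** The half-lines []a, +oo[] generate the Borel sets of the line, and the preimage of one under a
    projection is the union over n of quadrants whose other corner coordinate is - n. *)
Lemma measurable_quadrants :
  @measurable _ RR = <<s [set A | exists a c, A = quadrant a c] >>.
Proof.
set G := [set A | _].
apply/seteqP; split; last first.
  apply: smallest_sub; first exact: sigma_algebra_measurable.
  by move=> _ [a [c ->]]; exact: measurable_quadrant.
rewrite measurable_prod_measurableType.
apply: smallest_sub; first exact: smallest_sigma_algebra.
have m1 : measurable_fun [set: g_sigma_algebraType G] (fst : R * R -> measurableTypeR R).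
  apply: (measurability _ (RGenOInfty.measurableE R)).
  move=> _ [_ [a ->] <-]; rewrite setTI.
  have -> : fst @^-1` `]a, +oo[%classic = \bigcup_n quadrant a (- n%:R).
    apply/seteqP; split => p /=; rewrite in_itv/= andbT; last by case=> n _ [].
    move=> ap; exists (Num.bound `|p.2|) => //; split => //=.
    have := archi_boundP (normr_ge0 p.2); rewrite ltrNl.
    by apply: le_lt_trans; rewrite -normrN ler_norm.
  by apply: bigcupT_measurable => n; apply: sub_sigma_algebra; exists a, (- n%:R).
have m2 : measurable_fun [set: g_sigma_algebraType G] (snd : R * R -> measurableTypeR R).
  apply: (measurability _ (RGenOInfty.measurableE R)).
  move=> _ [_ [a ->] <-]; rewrite setTI.
  have -> : snd @^-1` `]a, +oo[%classic = \bigcup_n quadrant (- n%:R) a.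
    apply/seteqP; split => p /=; rewrite in_itv/= andbT; last by case=> n _ [].
    move=> ap; exists (Num.bound `|p.1|) => //; split => //=.
    have := archi_boundP (normr_ge0 p.1); rewrite ltrNl.
    by apply: le_lt_trans; rewrite -normrN ler_norm.
  by apply: bigcupT_measurable => n; apply: sub_sigma_algebra; exists (- n%:R), a.
move=> _ [A mA [B mB <-]].
rewrite (_ : A `*` B = (fst @^-1` A) `&` (snd @^-1` B))//.
have := @measurableI _ (g_sigma_algebraType G) (fst @^-1` A) (snd @^-1` B).
apply.
  by have := m1 measurableT A mA; rewrite setTI.
by have := m2 measurableT B mB; rewrite setTI.
Qed.

Lemma quadrantI a c a' c' :
  quadrant a c `&` quadrant a' c' = quadrant (Num.max a a') (Num.max c c').
Proof.
apply/seteqP; split => p; rewrite /quadrant /= !gt_max.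
  by move=> [[-> ->] [-> ->]].
by move=> [/andP[-> ->] /andP[-> ->]].
Qed.

(** A pi-lambda argument: the sets over which the integral of [g] vanishes form a Dynkin system,
    which contains the quadrants and hence every measurable set. *)
Lemma integral_eq0_quadrants (g : R * R -> R) :
  (leb2 R).-integrable (disc R) (EFin \o g) ->
  (forall a c, (\int[leb2 R]_(p in disc R `&` quadrant a c) (g p)%:E = 0)%E) ->
  ae_eq (leb2 R) (disc R) g (cst 0).
Proof.
move=> ig g0; have mD := @measurable_disc R.
have mg : measurable_fun (disc R) g by apply/measurable_EFinP; case/integrableP : ig.
pose L : set (set RR) := [set A | measurable A /\
  (\int[leb2 R]_(p in disc R `&` A) (g p)%:E = 0)%E].
have D0 : (\int[leb2 R]_(p in disc R) (g p)%:E = 0)%E.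
  (* This quadrant contains the whole disc; the vanishing total integral is what closes the system
     under complements. *)
  have <- := g0 (- 2) (- 2); congr (integral _ _ _); apply/esym/setIidPl => p.
  move=> /discP; case: p => x y /= xy; split => /=; have := sqr_ge0 x;
  by have := sqr_ge0 y; nra.
have igA (A : set RR) : measurable A ->
    (leb2 R).-integrable (disc R `&` A) (EFin \o g).
  by move=> mA; apply: (integrableS mD (measurableI _ _ mD mA) _ ig) => p [].
have dL : dynkin L.
  split.
  - by split; [exact: measurableT|rewrite setIT; exact: D0].
  - move=> A [mA A0]; split; first exact: measurableC.
    move: D0; have {1}-> : disc R = (disc R `&` A) `|` (disc R `&` ~` A).
      by rewrite -setIUr setUv setIT.
    rewrite integral_setU_EFin//.
    + by rewrite A0 add0e.
    + exact: measurableI.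
    + by apply: measurableI => //; exact: measurableC.
    + by rewrite -setIUr setUv setIT.
    + by apply/disj_setPS => p [[_ Ap] [_]].
  - move=> F tF LF; have mF n := (LF n).1.
    split; first exact: bigcupT_measurable.
    rewrite setI_bigcupr integral_bigcup.
    + by apply: eseries0 => n _ _; case: (LF n).
    + by apply: trivIset_setIl.
    + by move=> n; exact: (measurableI _ _ mD (mF n)).
    + by rewrite -setI_bigcupr; apply: igA; exact: bigcupT_measurable.
have HL (A : set RR) : measurable A -> L A.
  rewrite measurable_quadrants -setI_closed_g_dynkin_g_sigma_algebra; last first.
    move=> _ _ [a [c ->]] [a' [c' ->]]; rewrite quadrantI.
    by exists (Num.max a a'), (Num.max c c').
  apply: smallest_sub => // _ [a [c ->]]; split; last exact: g0.
  exact: measurable_quadrant.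
have : ae_eq (leb2 R) (disc R) (EFin \o g) (cst 0%E).
  apply: integral_ae_eq => //.
  move=> E ED mE; rewrite integral0.
  by have [_] := HL E mE; rewrite setIidr.
by apply: filterS => p H Dp; have := H Dp => -[].
Qed.

Definition flat1 : R -> R := flat 1.

Lemma flat1E x : flat1 x = if 0 < x then expR (- x^-1) else 0.
Proof. by rewrite /flat1 /flat hornerC mul1r. Qed.

Lemma flat1_bound x : 0 <= flat1 x <= 1.
Proof.
rewrite flat1E; case: ifPn => [x0|_]; last by rewrite lexx ler01.
by rewrite expR_ge0 expR_le1 oppr_le0 invr_ge0 ltW.
Qed.

Lemma cvg_flat1 (b s : R) : 0 < s -> flat1 (n%:R * s - b) @[n --> \oo] --> (1 : R).
Proof.
move=> s0; have H : n%:R * s - b @[n --> \oo] --> +oo.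
  apply/cvgryPge => A; near=> n.
  rewrite lerBrDr -ler_pdivrMr//; near: n; exact: nbhs_infty_ger.
have HV : expR (- (n%:R * s - b)^-1) @[n --> \oo] --> (1 : R).
  rewrite -[X in _ --> X]expR0; apply: continuous_cvg; first exact: continuous_expR.
  rewrite -[X in _ --> X]oppr0; apply: cvgN.
  have Hp : \forall n \near \oo, 0 < n%:R * s - b by move/cvgryPgt : H; apply.
  exact: (gtr0_cvgV0 Hp).2 H.
apply: cvg_trans HV; apply: near_eq_cvg; near=> n.
rewrite flat1E ifT//; near: n; move/cvgryPgt : H; apply.
Unshelve. all: by end_near. Qed.

Lemma flat1_le0 x : x <= 0 -> flat1 x = 0.
Proof. by move=> x0; rewrite flat1E ltNge x0. Qed.

(** The offset 1 in the first factor confines the support to n (1 - |p|^2) >= 1, a compact part of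
    the open disc. The other two factors tend to the indicators of the half-planes; their offset 0
    keeps the shape required by [cvg_flat1]. *)
Definition quadrant_bump (a c : R) (n : nat) (p : R * R) : R :=
  flat1 (n%:R * (1 - (p.1 ^+ 2 + p.2 ^+ 2)) - 1) *
  (flat1 (n%:R * (p.1 - a) - 0) * flat1 (n%:R * (p.2 - c) - 0)).

Lemma quadrant_bump_test a c n : test_function (quadrant_bump a c n).
Proof.
split.
  move=> k; apply: Ck_mul; first apply: Ck_flat.
    apply: Ck_sub; last exact: Ck_cst.
    apply: Ck_mul; first exact: Ck_cst.
    apply: Ck_sub; first exact: Ck_cst.
    by apply: Ck_add; apply: Ck_exp; [exact: Ck_fst|exact: Ck_snd].
  apply: Ck_mul; apply: Ck_flat; (apply: Ck_sub; last exact: Ck_cst);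
  (apply: Ck_mul; first exact: Ck_cst); (apply: Ck_sub; last exact: Ck_cst).
    exact: Ck_fst.
  exact: Ck_snd.
pose h (p : R * R) : R := n%:R * (1 - (p.1 ^+ 2 + p.2 ^+ 2)).
have ch : continuous h.
  apply: (@Ck_continuous _ 0); apply: Ck_mul; first exact: Ck_cst.
  apply: Ck_sub; first exact: Ck_cst.
  by apply: Ck_add; apply: Ck_exp; [exact: Ck_fst|exact: Ck_snd].
exists ((`[(-1), 1] `*` `[(-1), 1]) `&` (h @^-1` [set x | 1 <= x])); split.
- apply: compact_closedI; first by apply: compact_setX; exact: segment_compact.
  by apply: closed_comp; [move=> x _; exact: ch|exact: closed_ge].
- move=> p [_ /= hp]; apply/discP; rewrite ltNge; apply/negP => p1.
  by move: hp; rewrite leNgt (le_lt_trans _ ltr01)// mulr_ge0_le0// subr_le0.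
- move=> p Kp; rewrite /quadrant_bump [X in X * _]flat1_le0 ?mul0r//.
  rewrite subr_le0 leNgt; apply/negP => /ltW hp; apply: Kp; split => //.
  have : p.1 ^+ 2 + p.2 ^+ 2 < 1.
    rewrite ltNge; apply/negP => p1.
    by move: hp; rewrite leNgt (le_lt_trans _ ltr01)// mulr_ge0_le0// subr_le0.
  case: p {hp} => x y /= xy.
  by split; rewrite /= in_itv/=; apply/andP; split; have := sqr_ge0 x;
    have := sqr_ge0 y; nra.
Qed.

Lemma cvg_quadrant_bump a c (p : R * R) : disc R p ->
  quadrant_bump a c n p @[n --> \oo] --> (\1_(quadrant a c) p : R).
Proof.
move=> /discP Dp; rewrite indicE.
have [pQ|pQ] := boolP (p \in quadrant a c).
  move: pQ; rewrite inE => -[pa pc].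
  have -> : (true%:R : R) = 1 * (1 * 1) by rewrite !mulr1.
  by apply: cvgM; [|apply: cvgM]; apply: cvg_flat1; rewrite subr_gt0.
have H n : quadrant_bump a c n p = 0.
  move: pQ; rewrite notin_setE /quadrant /= => /not_andP pQ.
  rewrite /quadrant_bump; case: pQ => /negP; rewrite -leNgt => H.
    rewrite [X in _ * (X * _)]flat1_le0 ?mul0r ?mulr0//.
    by rewrite subr0 mulr_ge0_le0// subr_le0.
  rewrite [X in _ * (_ * X)]flat1_le0 ?mulr0//.
  by rewrite subr0 mulr_ge0_le0// subr_le0.
by under eq_fun do rewrite H; exact: cvg_cst.
Qed.

(** The bumps take values in [0, 1] and tend pointwise on the disc to the indicator of a quadrant,
    so dominated convergence with majorant |g| shows that [g] integrates to 0 over every quadrant.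
    No mollification is involved. *)
Lemma test_function_separates (g : R * R -> R) :
  (leb2 R).-integrable (disc R) (EFin \o g) ->
  (forall phi, test_function phi ->
    \int[leb2 R]_(p in disc R) (g p * phi p) = 0) ->
  ae_eq (leb2 R) (disc R) g (cst 0).
Proof.
move=> ig H; have mD := @measurable_disc R.
have mg : measurable_fun (disc R) g by apply/measurable_EFinP; case/integrableP : ig.
apply: integral_eq0_quadrants => // a c.
have mb n : measurable_fun (disc R) (quadrant_bump a c n).
  have [/(_ 0%N) b0 _] := quadrant_bump_test a c n.
  by apply: measurable_funS (continuous_measurable_prod (Ck_continuous b0)).
have bb n p : `|quadrant_bump a c n p| <= 1.
  rewrite /quadrant_bump.
  have := flat1_bound (n%:R * (1 - (p.1 ^+ 2 + p.2 ^+ 2)) - 1).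
  have := flat1_bound (n%:R * (p.1 - a) - 0).
  have := flat1_bound (n%:R * (p.2 - c) - 0).
  move=> /andP[z0 z1] /andP[y0 y1] /andP[x0 x1].
  by rewrite ger0_norm ?mulr_ge0// !mulr_ile1 ?mulr_ge0.
have mQ := measurable_quadrant a c.
have [] := @dominated_convergence _ RR R (leb2 R) (disc R) mD
  (fun n p => (g p * quadrant_bump a c n p)%:E)
  (fun p => (g p * \1_(quadrant a c) p)%:E) (fun p => `|(g p)%:E|%E).
- by move=> n; apply/measurable_EFinP; exact: (measurable_funM mg (mb n)).
- by apply/measurable_EFinP; exact: (measurable_funM mg (measurable_indic mQ)).
- apply: aeW => p Dp; apply: cvg_EFin; first exact: nearW.
  by apply: cvgMr; exact: cvg_quadrant_bump.
- exact: integrable_abse.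
- apply: aeW => p n Dp; rewrite /= lee_fin normrM.
  by rewrite -[leRHS]mulr1 ler_wpM2l.
move=> _ _.
have -> : (fun n => \int[leb2 R]_(p in disc R) (g p * quadrant_bump a c n p)%:E)%E
  = fun=> 0%E.
  apply/funext => n; have := H _ (quadrant_bump_test a c n).
  (* [fine] also sends infinite values to 0, so integrability of the product is required to return
     to the extended integral. *)
  rewrite /Rintegral => /eqP; rewrite fine_eq0; first by move/eqP.
  apply: integrable_fin_num => //.
  have := @integrable_mulM _ RR R (leb2 R) (disc R) mD (quadrant_bump a c n) g 1.
  move/(_ (mb n) (fun p _ => bb n p) ig); apply: eq_integrable => // p _ /=.
  by rewrite mulrC.
move=> cv; have := cvg_unique _ cv (cvg_cst 0%E).
move=> <- //; rewrite integral_mkcondr; apply: eq_integral => p _.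
rewrite patchE indicE; case: ifPn => _; rewrite ?mulr1 ?mulr0//.
Qed.

End FundamentalLemma.

(** * Green's formula for Sobolev functions *)

Section Green.
Variable R : realType.
Notation mu := (@lebesgue_measure R).
Notation circle := [set` `[- (pi : R), (pi : R)]].
Notation mD := (@measurable_disc R).
Implicit Types (w f F : R * R -> R) (dw : bool -> R * R -> R) (g : R -> R).

(* [w] is in W^{1,2} of the disc with gradient [dw] and trace [g], in the sense
   that C^1 functions on the plane approximate all three; unlike [has_trace]
   this is manifestly linear. *)
Definition traceable w dw g : Prop :=
  [/\ L2 w, forall i, L2 (dw i), square_integrable mu circle g &
   exists phi : nat -> R * R -> R,
   [/\ (forall k, Ck setT 1 (phi k)),
       cvg_L2 (leb2 R) (disc R) phi w,
       (forall i, cvg_L2 (leb2 R) (disc R) (fun k => partial i (phi k)) (dw i)) &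
       cvg_L2 mu circle (fun k t => phi k (circle_pt t)) g]].

Lemma continuous_measurable_disc f : continuous f -> measurable_fun (disc R) f.
Proof. by move=> cf; apply: measurable_funS (continuous_measurable_prod cf). Qed.

Lemma continuous_L2 f : continuous f -> L2 f.
Proof.
move=> cf; have [M HM] := continuous_bounded_disc cf.
apply: (@square_integrable_bounded _ _ _ (leb2 R) (disc R) mD f M).
- exact: leb2_disc_lty.
- exact: continuous_measurable_disc.
- by move=> p Dp; exact: HM (ltW Dp).
Qed.

Lemma enorm_circle_pt t : enorm (@circle_pt R t) = 1.
Proof. by rewrite /enorm /= cos2Dsin2 sqrtr1. Qed.

Lemma continuous_circle f : continuous f -> continuous (fun t => f (circle_pt t)).
Proof.
exact: (continuous_pair (@continuous_cos R) (@continuous_sin R)).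
Qed.

Lemma continuous_circle_normal i : continuous (@circle_normal R i).
Proof.
by case: i => t; rewrite /circle_normal; [exact: continuous_sin|exact: continuous_cos].
Qed.

Lemma measurable_circle : measurable (circle : set (measurableTypeR R)).
Proof. exact: measurable_itv. Qed.

Lemma continuous_measurable_circle g : continuous g -> measurable_fun circle g.
Proof.
move=> cg.
by apply: (@measurable_funS _ _ _ _ setT) (continuous_measurable_fun cg).
Qed.

Lemma continuous_square_integrable_circle g : continuous g ->
  square_integrable mu circle g.
Proof.
move=> cg; apply: (integrable_square measurable_circle).
  exact: continuous_measurable_circle.
apply: integrable_continuous; under eq_fun do rewrite expr2.
by move=> t; apply: cvgM; exact: cg.
Qed.

Lemma L2_mul f f' : L2 f -> L2 f' ->
  (leb2 R).-integrable (disc R) (EFin \o (fun p => f p * f' p)).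
Proof. exact: (square_integrable_mul mD). Qed.

Lemma Ck_traceable f : Ck setT 1 f ->
  traceable f (fun i => partial i f) (fun t => f (circle_pt t)).
Proof.
move=> f1; have cf := Ck_continuous f1.
have cp i := Ck_continuous (CkS_partial i f1).
split.
- exact: continuous_L2.
- by move=> i; exact: continuous_L2.
- exact/continuous_square_integrable_circle/continuous_circle.
- by exists (fun=> f); split=> // [|i|]; exact: cvg_L2_cst.
Qed.

Lemma traceable_sub w w' dw dw' g g' : traceable w dw g -> traceable w' dw' g' ->
  traceable (fun p => w p - w' p) (fun i p => dw i p - dw' i p)
    (fun t => g t - g' t).
Proof.
move=> [wL dwL gL [phi [phi1 phiw phidw phig]]].
move=> [wL' dwL' gL' [psi [psi1 psiw psidw psig]]].
have cphi k := Ck_continuous (phi1 k).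
have cpsi k := Ck_continuous (psi1 k).
have cdphi k i := Ck_continuous (CkS_partial i (phi1 k)).
have cdpsi k i := Ck_continuous (CkS_partial i (psi1 k)).
split.
- exact: (square_integrable_sub mD wL wL').
- by move=> i; exact: (square_integrable_sub mD (dwL i) (dwL' i)).
- exact: (square_integrable_sub measurable_circle gL gL').
exists (fun k p => phi k p - psi k p); split.
- by move=> k; exact: Ck_sub.
- exact: (cvg_L2_sub mD (fun k => continuous_L2 (cphi k))
    (fun k => continuous_L2 (cpsi k)) wL wL' phiw psiw).
- move=> i.
  have -> : (fun k => partial i (fun p => phi k p - psi k p)) =
            (fun k p => partial i (phi k) p - partial i (psi k) p).
    apply/funext => k; apply/funext => p.
    have H := is_derive_add (CkS_is_derive i p (phi1 k))
      (is_derive_opp (CkS_is_derive i p (psi1 k))).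
    by rewrite {1}/partial; case: H.
  exact: (cvg_L2_sub mD (fun k => continuous_L2 (cdphi k i))
    (fun k => continuous_L2 (cdpsi k i)) (dwL i) (dwL' i) (phidw i) (psidw i)).
- have SC f : continuous f -> square_integrable mu circle (fun t => f (circle_pt t)).
    by move=> cf; exact/continuous_square_integrable_circle/continuous_circle.
  exact: (cvg_L2_sub measurable_circle (fun k => SC _ (cphi k))
    (fun k => SC _ (cpsi k)) gL gL' phig psig).
Qed.

(** This is the divergence theorem for the product F f f'. Carrying a weight and two functions lets
    a single passage to the limit produce the linear identities (one function equal to 1) as well as
    the quadratic ones. *)
Lemma Green_smooth F f f' i : Ck setT 1 F -> Ck setT 1 f -> Ck setT 1 f' ->
  \int[leb2 R]_(p in disc R) (F p * (f p * partial i f' p)) +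
  \int[leb2 R]_(p in disc R) (F p * (f' p * partial i f p)) +
  \int[leb2 R]_(p in disc R) (partial i F p * (f p * f' p)) =
  \int[mu]_(t in circle)
    ((F (circle_pt t) * circle_normal i t) * (f (circle_pt t) * f' (circle_pt t))).
Proof.
move=> F1 f1 f1'.
have cF := Ck_continuous F1; have cf := Ck_continuous f1.
have cf' := Ck_continuous f1'.
have cdF := Ck_continuous (CkS_partial i F1).
have cdf := Ck_continuous (CkS_partial i f1).
have cdf' := Ck_continuous (CkS_partial i f1').
have c3 (a b c : R * R -> R) : continuous a -> continuous b -> continuous c ->
    continuous (fun p => a p * (b p * c p)).
  move=> ca cb cc p; apply: cvgM; first exact: ca.
  by apply: cvgM; [exact: cb|exact: cc].
have H1 := integrable_disc_continuous (c3 _ _ _ cF cf cdf').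
have H2 := integrable_disc_continuous (c3 _ _ _ cF cf' cdf).
have H3 := integrable_disc_continuous (c3 _ _ _ cdF cf cf').
rewrite -RintegralD//; try exact: mD.
have H12 := integrableD mD H1 H2.
rewrite -RintegralD//; try exact: mD.
have E : (fun p => F p * (f p * partial i f' p) + F p * (f' p * partial i f p) +
      partial i F p * (f p * f' p)) =
     partial i (fun p => F p * (f p * f' p)).
  apply/funext => p.
  have H := is_derive_mul (CkS_is_derive i p F1)
     (is_derive_mul (CkS_is_derive i p f1) (CkS_is_derive i p f1')).
  by rewrite [RHS]/partial; case: H => _ ->; ring.
rewrite E (divergence_disc i (Ck_mul F1 (Ck_mul f1 f1'))).
by apply: eq_Rintegral => t _; ring.
Qed.

(** Each of the four integrals is a bounded weight against a product of two functions, so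
    [cvg_L2_mul] carries the smooth identity to the limit along the approximating sequences. *)
Lemma Green F w w' dw dw' g g' i : Ck setT 1 F ->
  traceable w dw g -> traceable w' dw' g' ->
  \int[leb2 R]_(p in disc R) (F p * (w p * dw' i p)) +
  \int[leb2 R]_(p in disc R) (F p * (w' p * dw i p)) +
  \int[leb2 R]_(p in disc R) (partial i F p * (w p * w' p)) =
  \int[mu]_(t in circle)
    ((F (circle_pt t) * circle_normal i t) * (g t * g' t)).
Proof.
move=> F1 [wL dwL gL [phi [phi1 phiw phidw phig]]].
move=> [wL' dwL' gL' [psi [psi1 psiw psidw psig]]].
have cphi k := Ck_continuous (phi1 k).
have cpsi k := Ck_continuous (psi1 k).
have cdphi k := Ck_continuous (CkS_partial i (phi1 k)).
have cdpsi k := Ck_continuous (CkS_partial i (psi1 k)).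
have cF := Ck_continuous F1.
have cdF := Ck_continuous (CkS_partial i F1).
have [M HM] := continuous_bounded_disc cF.
have [M' HM'] := continuous_bounded_disc cdF.
have mF := continuous_measurable_disc cF.
have mdF := continuous_measurable_disc cdF.
have bF p : disc R p -> `|F p| <= M by move=> /ltW; exact: HM.
have bdF p : disc R p -> `|partial i F p| <= M' by move=> /ltW; exact: HM'.
have L k := continuous_L2 (cphi k).
have L' k := continuous_L2 (cpsi k).
have dL k := continuous_L2 (cdphi k).
have dL' k := continuous_L2 (cdpsi k).
have C1 := cvg_L2_mul mD L dL' wL (dwL' i) mF bF phiw (psidw i).
have C2 := cvg_L2_mul mD L' dL wL' (dwL i) mF bF psiw (phidw i).
have C3 := cvg_L2_mul mD L L' wL wL' mdF bdF phiw psiw.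
have cN : continuous (fun t => F (circle_pt t) * circle_normal i t).
  move=> t; apply: cvgM; first exact: (continuous_circle cF).
  exact: continuous_circle_normal.
have bN t : circle t -> `|F (circle_pt t) * circle_normal i t| <= M.
  move=> _; rewrite normrM -[M]mulr1; apply: ler_pM => //.
    by apply: HM; rewrite enorm_circle_pt.
  by case: (i); [exact: sin_max|exact: cos_max].
have SC f : continuous f -> square_integrable mu circle (fun t => f (circle_pt t)).
  by move=> cf; apply: continuous_square_integrable_circle; exact: continuous_circle.
have C4 := cvg_L2_mul measurable_circle (fun k => SC _ (cphi k))
  (fun k => SC _ (cpsi k)) gL gL' (continuous_measurable_circle cN) bN phig psig.
have E := funext (fun k => Green_smooth i F1 (phi1 k) (psi1 k)).
rewrite -E in C4.
rewrite -[RHS](cvg_lim (@Rhausdorff R) C4); apply/esym/cvg_lim => //.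
by apply: cvgD; [exact: cvgD|].
Qed.

(** [xget] falls back on the zero function only if no weak derivative exists, which [f] excludes. *)
Lemma weak_partialP i w f : is_weak_partial i w f ->
  is_weak_partial i w (weak_partial i w).
Proof. by move=> fw; rewrite /weak_partial; case: xgetP => [//|/(_ f)]. Qed.

Lemma has_trace_traceable w g : has_trace w g ->
  traceable w (fun i => weak_partial i w) g.
Proof.
move=> [[wL wS] mg ig phiP]; split => // i.
by have [h hw _] := wS i; case: (weak_partialP hw).
Qed.

End Green.

Lemma Rintegral0_eq d (T : measurableType d) (R : realType)
    (mu : {measure set T -> \bar R}) (D : set T) (f : T -> R) :
  (forall x, D x -> f x = 0) -> \int[mu]_(x in D) f x = 0.
Proof.
by move=> f0; rewrite /Rintegral integral0_eq// => x Dx; rewrite f0.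
Qed.

(** * Weak derivatives and traces of functions almost everywhere equal to a smooth one *)

Section WeakDerivatives.
Variable R : realType.
Notation mu := (@lebesgue_measure R).
Notation circle := [set` `[- (pi : R), (pi : R)]].
Notation mD := (@measurable_disc R).
Implicit Types (w f : R * R -> R) (dw : bool -> R * R -> R).

Lemma ae_eq_L2 w f : measurable_fun (disc R) w -> L2 f ->
  ae_eq (leb2 R) (disc R) w f -> L2 w.
Proof.
move=> mw [mf fi] wf; split=> //.
rewrite (@ae_eq_integral _ _ _ (leb2 R) (disc R) (fun x => (f x ^+ 2)%:E))//.
- exact: mD.
- by apply/measurable_EFinP; exact: measurable_funX.
- by apply/measurable_EFinP; exact: measurable_funX.
- by apply: filterS wf => x H Dx; rewrite H.
Qed.

Lemma test_function_circle phi t : test_function phi -> phi (@circle_pt R t) = 0.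
Proof.
move=> [_ [K [_ KD K0]]]; apply: K0 => /KD.
by rewrite /disc /= enorm_circle_pt ltxx.
Qed.

(** The divergence theorem for f phi has no boundary term, as test functions vanish on the circle.
    Equality of [w] and [f] is asked only almost everywhere, so that the lemma applies again to a
    chosen weak derivative. *)
Lemma is_weak_partial_smooth i w f : Ck setT 1 f -> measurable_fun (disc R) w ->
  ae_eq (leb2 R) (disc R) w f -> is_weak_partial i w (partial i f).
Proof.
move=> f1 mw wf; have cf := Ck_continuous f1.
have cdf := Ck_continuous (CkS_partial i f1).
split.
- exact: ae_eq_L2 mw (continuous_L2 cf) wf.
- exact: continuous_L2.
move=> phi tphi; have phi1 := tphi.1 1.
have cphi := Ck_continuous phi1.
have cdphi := Ck_continuous (CkS_partial i phi1).
have mf := continuous_measurable_disc cf.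
have mdphi := continuous_measurable_disc cdphi.
rewrite (@ae_eq_Rintegral _ _ _ (leb2 R) (disc R) mD _ (fun x => f x * partial i phi x)).
- have := divergence_disc i (Ck_mul f1 phi1).
  have -> : partial i (fun x => f x * phi x) =
            (fun x => f x * partial i phi x + partial i f x * phi x).
    apply/funext => p; rewrite [LHS]/partial.
    have := is_derive_mul (CkS_is_derive i p f1) (CkS_is_derive i p phi1).
    by case=> _ ->; rewrite addrC.
  rewrite RintegralD//; first last.
  + apply: integrable_disc_continuous => x.
    by apply: cvgM; [exact: cdf|exact: cphi].
  + apply: integrable_disc_continuous => x.
    by apply: cvgM; [exact: cf|exact: cdphi].
  + exact: mD.
  have -> : \int[mu]_(t in circle)
      (f (circle_pt t) * phi (circle_pt t) * circle_normal i t) = 0.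
    apply: Rintegral0_eq => t _.
    by rewrite (test_function_circle t tphi) mulr0 mul0r.
  by move/eqP; rewrite addr_eq0 => /eqP.
- exact: measurable_funM.
- exact: measurable_funM.
- by apply: filterS wf => x H Dx; rewrite H.
Qed.

(** Both defining identities have the same left-hand side, so f - f' integrates to 0 against every
    test function; it is integrable because it is in [L2] and so is the constant 1. *)
Lemma is_weak_partial_unique i w f f' : is_weak_partial i w f ->
  is_weak_partial i w f' -> ae_eq (leb2 R) (disc R) f f'.
Proof.
move=> [_ fL fP] [_ fL' fP'].
have L1 : L2 (fun=> 1 : R) by apply: continuous_L2 => x; exact: cvg_cst.
have dL : L2 (fun x => f x - f' x) by exact: (square_integrable_sub mD fL fL').
suff : ae_eq (leb2 R) (disc R) (fun x => f x - f' x) (cst 0).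
  by apply: filterS => x H Dx; apply/eqP; rewrite -subr_eq0; apply/eqP; exact: H.
apply: test_function_separates.
  by have := L2_mul dL L1; under eq_fun do rewrite mulr1.
move=> phi tphi; have phiL := continuous_L2 (Ck_continuous (tphi.1 0)).
under eq_Rintegral do rewrite mulrBl.
rewrite RintegralB; [|exact: mD|exact: L2_mul|exact: L2_mul].
apply/eqP; rewrite subr_eq0; apply/eqP/oppr_inj.
by rewrite -fP// -fP'.
Qed.

Lemma weak_partial_smooth i w f : Ck setT 1 f -> measurable_fun (disc R) w ->
  ae_eq (leb2 R) (disc R) w f ->
  ae_eq (leb2 R) (disc R) (weak_partial i w) (partial i f).
Proof.
move=> f1 mw wf; have H := is_weak_partial_smooth i f1 mw wf.
exact: is_weak_partial_unique (weak_partialP H) H.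
Qed.

Lemma sobolev1_smooth w f : Ck setT 1 f -> measurable_fun (disc R) w ->
  ae_eq (leb2 R) (disc R) w f -> sobolev 1 w.
Proof.
move=> f1 mw wf; split.
  exact: ae_eq_L2 mw (continuous_L2 (Ck_continuous f1)) wf.
move=> i; exists (partial i f); first exact: is_weak_partial_smooth.
by split=> //; exact/continuous_L2/(Ck_continuous (CkS_partial i f1)).
Qed.

Lemma sobolev2_smooth w f : Ck setT 2 f -> measurable_fun (disc R) w ->
  ae_eq (leb2 R) (disc R) w f -> sobolev 2 w.
Proof.
move=> f2 mw wf; have f1 := CkW f2; split.
  exact: ae_eq_L2 mw (continuous_L2 (Ck_continuous f1)) wf.
move=> i; exists (partial i f); first exact: is_weak_partial_smooth.
apply: (sobolev1_smooth (CkS_partial i f2)); last exact: aeW.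
by apply: continuous_measurable_disc; exact: (Ck_continuous (CkS_partial i f1)).
Qed.

Lemma integral_sub_ae_eq0 w f : measurable_fun (disc R) w ->
  measurable_fun (disc R) f -> ae_eq (leb2 R) (disc R) w f ->
  (\int[leb2 R]_(x in disc R) ((f x - w x) ^+ 2)%:E = 0)%E.
Proof.
move=> mw mf wf.
rewrite (@ae_eq_integral _ _ _ (leb2 R) (disc R) (cst 0%E))//.
- by rewrite integral0.
- exact: mD.
- by apply/measurable_EFinP; apply: measurable_funX; exact: measurable_funB.
- by apply: filterS wf => x H Dx; rewrite H// subrr expr0n.
Qed.

Lemma has_trace_smooth w f : Ck setT 1 f -> measurable_fun (disc R) w ->
  ae_eq (leb2 R) (disc R) w f -> has_trace w (fun t => f (circle_pt t)).
Proof.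
move=> f1 mw wf; have cf := Ck_continuous f1.
have [mc ic] := continuous_square_integrable_circle (continuous_circle cf).
have dw i := weak_partialP (is_weak_partial_smooth i f1 mw wf).
split => //; first exact: sobolev1_smooth f1 mw wf.
exists (fun=> f); split => //.
- rewrite integral_sub_ae_eq0//; first exact: cvg_cst.
  exact: continuous_measurable_disc.
- move=> i; rewrite integral_sub_ae_eq0//; first exact: cvg_cst.
  + by case: (dw i) => _ [].
  + by apply: continuous_measurable_disc; exact: (Ck_continuous (CkS_partial i f1)).
  + exact: weak_partial_smooth.
- under eq_fun do under eq_integral do rewrite subrr expr0n.
  by rewrite integral0; exact: cvg_cst.
Qed.

End WeakDerivatives.

(** * Green's formulas under zero trace and zero normal trace *)

Section SecondOrder.
Variable R : realType.
Notation mu := (@lebesgue_measure R).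
Notation circle := [set` `[- (pi : R), (pi : R)]].
Notation mD := (@measurable_disc R).
Variables (w : R * R -> R) (dw : bool -> R * R -> R).
Variables (ddw : bool -> bool -> R * R -> R) (g : R -> R) (h : bool -> R -> R).
Hypothesis wT : traceable w dw g.
Hypothesis dwT : forall i, traceable (dw i) (ddw i) (h i).
Hypothesis g0 : forall t, g t = 0.
Hypothesis h0 : {ae mu, forall t : R, - pi <= t <= pi ->
  h false t * cos t + h true t * sin t = 0}.

Let lap p := ddw false false p + ddw true true p.

Let wL : L2 w. Proof. by case: wT. Qed.
Let dwL i : L2 (dw i). Proof. by case: (dwT i). Qed.
Let ddwL i j : L2 (ddw i j). Proof. by case: (dwT i). Qed.
Let hL i : square_integrable mu circle (h i). Proof. by case: (dwT i). Qed.
Let lapL : L2 lap. Proof. exact: (square_integrable_add mD (ddwL _ _) (ddwL _ _)). Qed.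

Let partial1 i (p : R * R) : partial i (fun=> 1 : R) p = 0.
Proof. exact: derive_cst. Qed.

(** The case of [Green] in which one of the two functions is the constant 1. *)
Lemma Green_linear (F v : R * R -> R) dv (k : R -> R) i :
  Ck setT 1 F -> traceable v dv k ->
  \int[leb2 R]_(p in disc R) (F p * dv i p) +
  \int[leb2 R]_(p in disc R) (partial i F p * v p) =
  \int[mu]_(t in circle) (F (circle_pt t) * circle_normal i t * k t).
Proof.
move=> F1 vT; have := Green i F1 (Ck_traceable (Ck_cst 1 (1 : R))) vT.
under eq_Rintegral do rewrite mul1r.
under [X in _ + X + _]eq_Rintegral do rewrite partial1 !mulr0.
under [X in _ + _ + X]eq_Rintegral do rewrite mul1r.
under [X in _ = X]eq_Rintegral do rewrite mul1r.
by rewrite [X in _ + X + _]Rintegral0_eq ?addr0.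
Qed.

(** The hypothesis kills only the combination h . n, not its two components, so the boundary terms
    of both directions must be added before they vanish. *)
Lemma Rintegral_circle_normal_trace (F : R * R -> R) : continuous F ->
  \int[mu]_(t in circle) (F (circle_pt t) * circle_normal false t * h false t) +
  \int[mu]_(t in circle) (F (circle_pt t) * circle_normal true t * h true t) = 0.
Proof.
move=> cF; have mC := @measurable_circle R.
have [M HM] := continuous_bounded_disc cF.
have cN i : continuous (fun t => F (circle_pt t) * circle_normal i t).
  move=> t; apply: cvgM; first exact: (continuous_circle cF).
  exact: continuous_circle_normal.
have I i : mu.-integrable circle
    (EFin \o (fun t => F (circle_pt t) * circle_normal i t * h i t)).
  apply: (square_integrable_mul mC _ (hL i)).
  exact: continuous_square_integrable_circle.
rewrite -RintegralD//.
rewrite (@ae_eq_Rintegral _ _ _ _ _ mC _ (cst 0)).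
- by rewrite Rintegral0_eq.
- by apply/measurable_EFinP; have := integrableD mC (I false) (I true); case/integrableP.
- exact: measurable_cst.
- have [N [mN N0 subN]] := h0; exists N; split=> // t /= tN; apply: subN => /= H.
  apply: tN; rewrite in_itv /= => /H; rewrite /circle_normal => E.
  by rewrite -!mulrA -mulrDr [cos t * _]mulrC [sin t * _]mulrC E mulr0.
Qed.

(** Two integrations by parts in each direction. The boundary term of one is Q times the normal
    trace, which vanishes after summation over the directions; that of the other contains the trace
    [g] and vanishes in each direction. *)
Lemma Green_laplacian (Q : R * R -> R) : Ck setT 2 Q ->
  \int[leb2 R]_(p in disc R) (Q p * lap p) =
  \int[leb2 R]_(p in disc R)
    ((partial false (partial false Q) p + partial true (partial true Q) p) * w p).
Proof.
move=> Q2; have Q1 := CkW Q2; have Q1' i := CkS_partial i Q2.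
have cQ := Ck_continuous Q2.
have cQ' i := Ck_continuous (Q1' i).
have cQ'' i := Ck_continuous (CkS_partial i (Q1' i)).
have iQ'' i := L2_mul (continuous_L2 (cQ'' i)) wL.
have iQ i := L2_mul (continuous_L2 cQ) (ddwL i i).
have G1 i := Green_linear i Q1 (dwT i).
have G2 i := Green_linear i (Q1' i) wT.
have B := Rintegral_circle_normal_trace cQ.
have Z i : \int[mu]_(t in circle)
    (partial i Q (circle_pt t) * circle_normal i t * g t) = 0.
  by apply: Rintegral0_eq => t _; rewrite g0 mulr0.
under eq_Rintegral do rewrite mulrDr.
under [RHS]eq_Rintegral do rewrite mulrDl.
rewrite RintegralD; [|exact: mD|exact: iQ|exact: iQ].
rewrite RintegralD; [|exact: mD|exact: iQ''|exact: iQ''].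
have aux (b b' q q' c c' v v' : R) : b + b' = 0 -> q + c = b -> q' + c' = b' ->
    c + v = 0 -> c' + v' = 0 -> q + q' = v + v' by lra.
exact: (aux _ _ _ _ _ _ _ _ B (G1 false) (G1 true)
  (etrans (G2 false) (Z false)) (etrans (G2 true) (Z true))).
Qed.

(** Green's formula with weight 1 for [w] and [dw i], whose boundary term contains [g], turns the
    integral of w lap into minus that of |grad w|^2. Hence the gradient vanishes, and a Poincare
    identity transfers this to [w]. *)
Lemma null_laplacian : ae_eq (leb2 R) (disc R) lap (cst 0) ->
  ae_eq (leb2 R) (disc R) w (cst 0).
Proof.
move=> l0; have C1 := Ck_cst 1 (1 : R).
have ww i : \int[leb2 R]_(p in disc R) (w p * ddw i i p) +
    \int[leb2 R]_(p in disc R) (dw i p ^+ 2) = 0.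
  have := Green i C1 wT (dwT i).
  under eq_Rintegral do rewrite mul1r.
  under [X in _ + X + _]eq_Rintegral do rewrite mul1r -expr2.
  under [X in _ + _ + X]eq_Rintegral do rewrite partial1 mul0r.
  rewrite [X in _ + _ + X = _]Rintegral0_eq ?addr0// => ->.
  by apply: Rintegral0_eq => t _; rewrite g0 mul0r mulr0.
have wlap : \int[leb2 R]_(p in disc R) (w p * ddw false false p) +
    \int[leb2 R]_(p in disc R) (w p * ddw true true p) = 0.
  rewrite -RintegralD; [|exact: mD|exact: L2_mul|exact: L2_mul].
  rewrite (@ae_eq_Rintegral _ _ _ _ _ mD _ (cst 0)).
  - by rewrite Rintegral0_eq.
  - apply: measurable_funD; apply: measurable_funM; try exact: wL.1.
      exact: (ddwL _ _).1.
    exact: (ddwL _ _).1.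
  - exact: measurable_cst.
  - by apply: filterS l0 => p H Dp; rewrite -mulrDr -/(lap p) H// mulr0.
have pos i : 0 <= \int[leb2 R]_(p in disc R) (dw i p ^+ 2).
  by apply: Rintegral_ge0 => p _; exact: sqr_ge0.
have dw0 : \int[leb2 R]_(p in disc R) (dw false p ^+ 2) = 0.
  have aux (a a' b b' : R) : a + b = 0 -> a' + b' = 0 -> a + a' = 0 ->
    0 <= b -> 0 <= b' -> b = 0 by lra.
  exact: (aux _ _ _ _ (ww false) (ww true) wlap (pos false) (pos true)).
have {}dw0 : ae_eq (leb2 R) (disc R) (dw false) (cst 0).
  exact: (Rintegral_square_eq0 mD (dwL false) dw0).
(* The weight x_1 has derivative 1 in its own direction, so with zero trace the integral of w^2 is
   -2 times that of x_1 w (d_1 w). *)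
have := Green false (Ck_fst R 1) wT wT.
have E : \int[leb2 R]_(p in disc R) (p.1 * (w p * dw false p)) = 0.
  rewrite (@ae_eq_Rintegral _ _ _ _ _ mD _ (cst 0)).
  - by rewrite Rintegral0_eq.
  - apply: measurable_funM.
      by apply: continuous_measurable_disc => p; exact: cvg_fst.
    by apply: measurable_funM; [exact: wL.1|exact: (dwL _).1].
  - exact: measurable_cst.
  - by apply: filterS dw0 => p H Dp; rewrite H// !mulr0.
rewrite E add0r add0r.
have -> : \int[mu]_(t in circle)
    ((circle_pt t).1 * circle_normal false t * (g t * g t)) = 0.
  by apply: Rintegral0_eq => t _; rewrite g0 mul0r mulr0.
have P1 p : partial false (@fst R R) p = 1.
  by rewrite /partial; case: (is_derive_fst p false).
under eq_Rintegral do rewrite P1 mul1r -expr2.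
exact: (Rintegral_square_eq0 mD wL).
Qed.

End SecondOrder.

(** * The solution in parabolic coordinates *)

Section ObstacleSolution.
Variable R : realType.
Implicit Types p q : R * R.

Local Notation rad := (@enorm R).

Definition xi p : R := Num.sqrt ((rad p + p.1) / 2).

(** The absolute value of the imaginary part of the principal square root of p.1 + i p.2, of which
    [xi] is the real part. Thus |p| = xi^2 + zeta^2, p.1 = xi^2 - zeta^2 and |p.2| = 2 xi zeta. *)
Definition zeta p : R := Num.sqrt ((rad p - p.1) / 2).

(** With c = cos (phi / 2) and cos (5 phi / 2) = 16 c^5 - 20 c^3 + 5 c, the angular factor of the
    polar formula is 4 c^3 - (16/5) c^5; here c is rewritten as xi / sqrt |p|. *)
Definition solution p : R := 4 * rad p * xi p ^+ 3 - 16 / 5 * xi p ^+ 5.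

Definition solution_d (i : bool) p : R :=
  if i then 3 * p.2 * xi p else 2 * xi p ^+ 3.

(* At the origin the convention x / 0 = 0 gives the right value. *)
Definition solution_dd (i j : bool) p : R :=
  match i, j with
  | false, false => 3 * (xi p ^+ 3 / rad p)
  | true, true => 6 * xi p - 3 * (xi p ^+ 3 / rad p)
  | _, _ => 3 / 2 * (p.2 * xi p / rad p)
  end.

Lemma enorm_ge0 p : 0 <= rad p. Proof. exact: sqrtr_ge0. Qed.

Lemma enorm_sqr p : rad p ^+ 2 = p.1 ^+ 2 + p.2 ^+ 2.
Proof. by rewrite sqr_sqrtr// addr_ge0 ?sqr_ge0. Qed.

Lemma le_enorm1 p : `|p.1| <= rad p.
Proof. by rewrite -sqrtr_sqr ler_wsqrtr// lerDl sqr_ge0. Qed.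

Lemma le_enorm2 p : `|p.2| <= rad p.
Proof. by rewrite -sqrtr_sqr ler_wsqrtr// lerDr sqr_ge0. Qed.

Lemma enormN p : rad (- p) = rad p.
Proof. by rewrite /enorm /= !sqrrN. Qed.

Lemma enormD p q : rad (p + q) <= rad p + rad q.
Proof.
rewrite -(@ler_pXn2r _ 2)// ?nnegrE ?addr_ge0 ?enorm_ge0//.
have P0 := enorm_ge0 p; have Q0 := enorm_ge0 q.
have P2 := enorm_sqr p; have Q2 := enorm_sqr q.
rewrite enorm_sqr /=.
have H : p.1 * q.1 + p.2 * q.2 <= rad p * rad q.
  apply: (le_trans (ler_norm _)).
  rewrite -(@ler_pXn2r _ 2)// ?nnegrE ?mulr_ge0// real_normK ?num_real//.
  rewrite exprMn P2 Q2.
  (* Lagrange's identity: this square is the defect in the Cauchy-Schwarz inequality. *)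
  have := sqr_ge0 (p.1 * q.2 - p.2 * q.1); nra.
nra.
Qed.

Lemma enorm_lip p q : `|rad p - rad q| <= rad (p - q).
Proof.
have H1 : rad p <= rad (p - q) + rad q.
  by rewrite -{1}(subrK q p); exact: enormD.
have H2 : rad q <= rad (p - q) + rad p.
  by rewrite -[rad (p - q)]enormN opprB -{1}(subrK p q); exact: enormD.
by rewrite ler_norml; apply/andP; split; lra.
Qed.

Lemma xi_arg_ge0 p : 0 <= (rad p + p.1) / 2.
Proof. by have := le_enorm1 p; rewrite ler_norml => /andP[]; lra. Qed.

Lemma zeta_arg_ge0 p : 0 <= (rad p - p.1) / 2.
Proof. by have := le_enorm1 p; rewrite ler_norml => /andP[]; lra. Qed.

Lemma xi_ge0 p : 0 <= xi p. Proof. exact: sqrtr_ge0. Qed.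

Lemma zeta_ge0 p : 0 <= zeta p. Proof. exact: sqrtr_ge0. Qed.

Lemma xi_sqr p : xi p ^+ 2 = (rad p + p.1) / 2.
Proof. by rewrite sqr_sqrtr// xi_arg_ge0. Qed.

Lemma zeta_sqr p : zeta p ^+ 2 = (rad p - p.1) / 2.
Proof. by rewrite sqr_sqrtr// zeta_arg_ge0. Qed.

Lemma enorm_parabolic p : rad p = xi p ^+ 2 + zeta p ^+ 2.
Proof. by rewrite xi_sqr zeta_sqr; lra. Qed.

Lemma fst_parabolic p : p.1 = 2 * xi p ^+ 2 - rad p.
Proof. by rewrite xi_sqr; lra. Qed.

Lemma snd_parabolic p : `|p.2| = 2 * (xi p * zeta p).
Proof.
apply/eqP; rewrite -(@eqrXn2 _ 2)// ?mulr_ge0 ?xi_ge0 ?zeta_ge0//.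
apply/eqP; rewrite real_normK ?num_real// !exprMn xi_sqr zeta_sqr.
by have := enorm_sqr p; lra.
Qed.

Lemma snd_sqr_parabolic p : p.2 ^+ 2 = 4 * xi p ^+ 2 * (rad p - xi p ^+ 2).
Proof. by rewrite xi_sqr; have := enorm_sqr p; lra. Qed.

Lemma xi_sqr_le p : xi p ^+ 2 <= rad p.
Proof. by rewrite enorm_parabolic lerDl sqr_ge0. Qed.

Lemma solution_ge0 p : 0 <= solution p.
Proof.
have -> : solution p = 4 * xi p ^+ 3 * (rad p - 4 / 5 * xi p ^+ 2).
  by rewrite /solution; field.
apply: mulr_ge0; first by rewrite mulr_ge0// exprn_ge0// xi_ge0.
by have := xi_sqr_le p; have := sqr_ge0 (xi p); lra.
Qed.

Lemma solution_le p : solution p <= 4 * rad p * xi p ^+ 3.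
Proof.
by rewrite /solution gerBl mulr_ge0// ?exprn_ge0 ?xi_ge0.
Qed.

Lemma sqrt_holder (a b : R) : 0 <= a -> 0 <= b ->
  `|Num.sqrt a - Num.sqrt b| <= Num.sqrt `|a - b|.
Proof.
move=> a0 b0; wlog ba : a b a0 b0 / b <= a.
  move=> H; have [ba|/ltW ab] := leP b a; first exact: H.
  by have := H b a b0 a0 ab; rewrite distrC (distrC b a).
rewrite !ger0_norm ?subr_ge0 ?ler_wsqrtr//.
rewrite lerBlDr -(@ler_pXn2r _ 2)// ?nnegrE ?addr_ge0 ?sqrtr_ge0//.
have := sqr_sqrtr a0; have := sqr_sqrtr b0.
have ab : 0 <= a - b by rewrite subr_ge0.
have := sqr_sqrtr ab; have := sqrtr_ge0 (a - b); have := sqrtr_ge0 b.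
nra.
Qed.

(** The argument of the root is the mean of two functions that are 1-Lipschitz for the Euclidean
    length, and the square root is 1/2-Hoelder with constant 1. *)
Lemma xi_holder p q : `|xi p - xi q| <= Num.sqrt (rad (p - q)).
Proof.
apply: (le_trans (sqrt_holder (xi_arg_ge0 p) (xi_arg_ge0 q))).
apply: ler_wsqrtr; have := enorm_lip p q; have := le_enorm1 (p - q).
rewrite /= !ler_norml => /andP[a b] /andP[c d].
by apply/andP; split; lra.
Qed.

Lemma zeta_holder p q : `|zeta p - zeta q| <= Num.sqrt (rad (p - q)).
Proof.
apply: (le_trans (sqrt_holder (zeta_arg_ge0 p) (zeta_arg_ge0 q))).
apply: ler_wsqrtr; have := enorm_lip p q; have := le_enorm1 (p - q).
rewrite /= !ler_norml => /andP[a b] /andP[c d].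
by apply/andP; split; lra.
Qed.

Lemma holder_continuous (f : R * R -> R) (C : R) :
  (forall p q, `|f p - f q| <= C * Num.sqrt (rad (p - q))) -> continuous f.
Proof.
move=> H p; apply/cvgrPdist_lt => e e0.
have cg : continuous (fun q => C * Num.sqrt (rad (p - q))).
  move=> q; apply: cvgM; first exact: cvg_cst.
  apply: (@continuous_comp _ _ _ (fun q => rad (p - q)) Num.sqrt);
    last exact: sqrt_continuous.
  apply: (@continuous_comp _ _ _ (fun q => p - q) rad); last exact: continuous_enorm.
  by apply: cvgB; [exact: cvg_cst|exact: cvg_id].
have := cg p; rewrite /continuous_at subrr.
have -> : rad 0 = 0 by rewrite /enorm /= expr0n addr0 sqrtr0.
rewrite sqrtr0 mulr0 => /cvgrPdist_lt/(_ e e0); apply: filterS => q.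
rewrite sub0r normrN; apply: le_lt_trans.
by apply: le_trans (H p q) _; exact: ler_norm.
Qed.

Lemma continuous_xi : continuous xi.
Proof.
by apply: (@holder_continuous _ 1) => p q; rewrite mul1r; exact: xi_holder.
Qed.

(* The parabolic coordinates [xi] and [zeta] are 1/2-Hoelder, and the second
   derivatives of [solution] are, up to sign, combinations of them and of this
   Lipschitz function of them. *)
Definition cubic_ratio (a b : R) : R := a ^+ 2 * b / (a ^+ 2 + b ^+ 2).

(** The difference factors as a - c times a quotient whose absolute value is at most 1. If [b]
    vanishes, so do both ratios, including the one with zero denominator; otherwise the denominators
    are positive. *)
Lemma cubic_ratio_lip1 (a c b : R) :
  `|cubic_ratio a b - cubic_ratio c b| <= `|a - c|.
Proof.
have [->|b0] := eqVneq b 0; first by rewrite /cubic_ratio !mulr0 !mul0r subrr normr0.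
have b2 : 0 < b ^+ 2 by rewrite exprn_even_gt0.
have P : 0 < a ^+ 2 + b ^+ 2 by have := sqr_ge0 a; lra.
have Q : 0 < c ^+ 2 + b ^+ 2 by have := sqr_ge0 c; lra.
have -> : cubic_ratio a b - cubic_ratio c b =
  (a - c) * (b ^+ 3 * (a + c) / ((a ^+ 2 + b ^+ 2) * (c ^+ 2 + b ^+ 2))).
  by rewrite /cubic_ratio; field; rewrite !gt_eqF.
rewrite normrM -[leRHS]mulr1 ler_wpM2l// normrM normfV.
rewrite [X in _ / X]gtr0_norm ?mulr_gt0// ler_pdivrMr ?mulr_gt0// mul1r.
rewrite ler_norml; apply/andP; split.
  have := sqr_ge0 (a * c); have := sqr_ge0 (a * b); have := sqr_ge0 (c * b).
  have := mulr_ge0 (ltW b2) (sqr_ge0 (a + b)).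
  have := mulr_ge0 (ltW b2) (sqr_ge0 (c + b)).
  by lra.
have := sqr_ge0 (a * c); have := sqr_ge0 (a * b); have := sqr_ge0 (c * b).
have := mulr_ge0 (ltW b2) (sqr_ge0 (a - b)).
have := mulr_ge0 (ltW b2) (sqr_ge0 (c - b)).
by lra.
Qed.

Lemma cubic_ratio_lip2 (a b d : R) :
  `|cubic_ratio a b - cubic_ratio a d| <= `|b - d|.
Proof.
have [->|a0] := eqVneq a 0.
  by rewrite /cubic_ratio expr0n !mul0r subrr normr0.
have a2 : 0 < a ^+ 2 by rewrite exprn_even_gt0.
have P : 0 < a ^+ 2 + b ^+ 2 by have := sqr_ge0 b; lra.
have Q : 0 < a ^+ 2 + d ^+ 2 by have := sqr_ge0 d; lra.
have -> : cubic_ratio a b - cubic_ratio a d =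
  (b - d) * (a ^+ 2 * (a ^+ 2 - b * d) / ((a ^+ 2 + b ^+ 2) * (a ^+ 2 + d ^+ 2))).
  by rewrite /cubic_ratio; field; rewrite !gt_eqF.
rewrite normrM -[leRHS]mulr1 ler_wpM2l// normrM normfV.
rewrite [X in _ / X]gtr0_norm ?mulr_gt0// ler_pdivrMr ?mulr_gt0// mul1r.
rewrite ler_norml; apply/andP; split.
  have := sqr_ge0 (b * d); have := sqr_ge0 (a * b); have := sqr_ge0 (a * d).
  have := mulr_ge0 (ltW a2) (sqr_ge0 (b - d)).
  have := mulr_ge0 (ltW a2) (ltW a2).
  by lra.
have := sqr_ge0 (b * d); have := sqr_ge0 (a * b); have := sqr_ge0 (a * d).
have := mulr_ge0 (ltW a2) (sqr_ge0 (b + d)).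
have := mulr_ge0 (ltW a2) (sqr_ge0 b).
have := mulr_ge0 (ltW a2) (sqr_ge0 d).
by lra.
Qed.

Lemma cubic_ratio_lip (a b c d : R) :
  `|cubic_ratio a b - cubic_ratio c d| <= `|a - c| + `|b - d|.
Proof.
have -> : cubic_ratio a b - cubic_ratio c d =
  (cubic_ratio a b - cubic_ratio c b) + (cubic_ratio c b - cubic_ratio c d) by ring.
apply: le_trans (ler_normD _ _) _.
by apply: lerD; [exact: cubic_ratio_lip1|exact: cubic_ratio_lip2].
Qed.

Lemma enorm_eq0_xi p : rad p = 0 -> xi p = 0.
Proof.
move=> r0; apply/eqP; rewrite -sqrf_eq0 eq_le sqr_ge0 andbT.
by rewrite (le_trans (xi_sqr_le p))// r0.
Qed.

(** Rids the quotient of its singular denominator: what remains is a Hoelder coordinate minus a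
    Lipschitz function of Hoelder coordinates. *)
Lemma xi_cube_div p : xi p ^+ 3 / rad p = xi p - cubic_ratio (zeta p) (xi p).
Proof.
have [r0|r0] := eqVneq (rad p) 0.
  by rewrite /cubic_ratio enorm_eq0_xi// expr0n !mulr0 !mul0r subrr.
rewrite /cubic_ratio [zeta p ^+ 2 + _]addrC -enorm_parabolic.
have -> : zeta p ^+ 2 = rad p - xi p ^+ 2 by rewrite enorm_parabolic; ring.
by field.
Qed.

(** The parabolic coordinates forget the sign of [p.2], so only the absolute value of the mixed
    quotient is a function of them. *)
Lemma norm_cross p : `|p.2 * xi p / rad p| = 2 * cubic_ratio (xi p) (zeta p).
Proof.
rewrite /cubic_ratio -enorm_parabolic !normrM snd_parabolic.
by rewrite normfV (ger0_norm (xi_ge0 _)) (ger0_norm (enorm_ge0 _)); ring.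
Qed.

(** Needed for two points on opposite sides of the axis, where the mixed derivative changes sign and
    each value must be small by itself. After squaring it amounts to xi^3 zeta <= 2 |p|^2. *)
Lemma cubic_ratio_le p : cubic_ratio (xi p) (zeta p) <= Num.sqrt `|p.2|.
Proof.
have X0 := xi_ge0 p; have Z0 := zeta_ge0 p; have r0 := enorm_ge0 p.
have c0 : 0 <= cubic_ratio (xi p) (zeta p).
  by rewrite divr_ge0 ?mulr_ge0 ?addr_ge0 ?sqr_ge0.
rewrite -(@ler_pXn2r _ 2)// ?nnegrE ?sqrtr_ge0// sqr_sqrtr// snd_parabolic.
rewrite /cubic_ratio -enorm_parabolic.
have [->|rn0] := eqVneq (rad p) 0.
  by rewrite invr0 mulr0 expr0n mulr_ge0// mulr_ge0.
have rp : 0 < rad p ^+ 2 by rewrite exprn_even_gt0.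
rewrite expr_div_n ler_pdivrMr//.
have E := enorm_parabolic p.
have m0 : 0 <= xi p * zeta p by exact: mulr_ge0.
have K : xi p ^+ 3 * zeta p <= 2 * rad p ^+ 2.
  rewrite E; have := sqr_ge0 (xi p ^+ 2 - xi p * zeta p).
  have := sqr_ge0 (xi p ^+ 2); have := sqr_ge0 (zeta p ^+ 2).
  have := sqr_ge0 (xi p * zeta p); nra.
by have := ler_wpM2l m0 K; lra.
Qed.

End ObstacleSolution.

(** * Hoelder bounds and derivatives of the explicit solution *)

Section SolutionCalculus.
Variable R : realType.
Implicit Types (p q : R * R) (i j : bool).

Local Notation rad := (@enorm R).

Lemma xi_cube_div_holder p q :
  `|xi p ^+ 3 / rad p - xi q ^+ 3 / rad q| <= 3 * Num.sqrt (rad (p - q)).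
Proof.
rewrite !xi_cube_div.
have := cubic_ratio_lip (zeta p) (xi p) (zeta q) (xi q).
have := xi_holder p q; have := zeta_holder p q.
set a := cubic_ratio _ _; set b := cubic_ratio _ _.
have -> : xi p - a - (xi q - b) = (xi p - xi q) - (a - b) by ring.
have := ler_normB (xi p - xi q) (a - b).
by lra.
Qed.

(** The quotient has the sign of [p.2]. For ordinates of the same sign the difference is that of the
    absolute values, controlled by [cubic_ratio_lip]. Otherwise |p.2| and |q.2| are both at most
    |p.2 - q.2|, and [cubic_ratio_le] bounds each quotient separately. *)
Lemma cross_holder p q :
  `|p.2 * xi p / rad p - q.2 * xi q / rad q| <= 4 * Num.sqrt (rad (p - q)).
Proof.
have Cp := norm_cross p; have Cq := norm_cross q.
have N0 := sqrtr_ge0 (rad (p - q)).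
set a := p.2 * xi p / rad p in Cp *; set b := q.2 * xi q / rad q in Cq *.
have sa : 0 <= p.2 * a.
  have -> : p.2 * a = p.2 ^+ 2 * xi p / rad p by rewrite /a; ring.
  by rewrite divr_ge0 ?enorm_ge0// mulr_ge0 ?sqr_ge0 ?xi_ge0.
have sb : 0 <= q.2 * b.
  have -> : q.2 * b = q.2 ^+ 2 * xi q / rad q by rewrite /b; ring.
  by rewrite divr_ge0 ?enorm_ge0// mulr_ge0 ?sqr_ge0 ?xi_ge0.
have L := cubic_ratio_lip (xi p) (zeta p) (xi q) (zeta q).
have X := xi_holder p q; have Z := zeta_holder p q.
have same : `| `|a| - `|b| | <= 4 * Num.sqrt (rad (p - q)).
  rewrite Cp Cq -mulrBr normrM ger0_norm//.
  by move: L X Z; lra.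
have opp : p.2 * q.2 <= 0 -> `|a| + `|b| <= 4 * Num.sqrt (rad (p - q)).
  move=> pq; rewrite Cp Cq.
  have D := le_enorm2 (p - q); rewrite /= in D.
  have Dp : Num.sqrt `|p.2| <= Num.sqrt (rad (p - q)).
    apply: ler_wsqrtr; apply: le_trans D.
    rewrite -(@ler_pXn2r _ 2)// ?nnegrE// !real_normK ?num_real//.
    by have := sqr_ge0 q.2; nra.
  have Dq : Num.sqrt `|q.2| <= Num.sqrt (rad (p - q)).
    apply: ler_wsqrtr; apply: le_trans D.
    rewrite -(@ler_pXn2r _ 2)// ?nnegrE// !real_normK ?num_real//.
    by have := sqr_ge0 p.2; nra.
  by move: (cubic_ratio_le p) (cubic_ratio_le q); lra.
have a0 : p.2 = 0 -> a = 0 by rewrite /a => ->; rewrite !mul0r.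
have b0 : q.2 = 0 -> b = 0 by rewrite /b => ->; rewrite !mul0r.
have [p0|p0|p0] := ltgtP p.2 0; have [q0|q0|q0] := ltgtP q.2 0;
  try (by apply: le_trans (ler_normB _ _) (opp _);
       rewrite ?p0 ?q0 ?mul0r ?mulr0 //; nra).
- have an : a <= 0 by rewrite -(nmulr_rge0 _ p0).
  have bn : b <= 0 by rewrite -(nmulr_rge0 _ q0).
  by move: same; rewrite (ler0_norm an) (ler0_norm bn) -opprD normrN.
- have an : 0 <= a by rewrite -(pmulr_rge0 _ p0).
  have bn : 0 <= b by rewrite -(pmulr_rge0 _ q0).
  by move: same; rewrite (ger0_norm an) (ger0_norm bn).
Qed.

(** The constant comes from the second derivative in x_2: 6 from 6 xi, plus 3 times the constant 3
    of [xi_cube_div_holder]. *)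
Lemma solution_dd_holder i j p q :
  `|solution_dd i j p - solution_dd i j q| <= 15 * Num.sqrt (rad (p - q)).
Proof.
have N0 := sqrtr_ge0 (rad (p - q)).
have H1 := xi_cube_div_holder p q; have H2 := cross_holder p q.
have H3 := xi_holder p q.
case: i; case: j; rewrite /solution_dd.
- set a := xi p ^+ 3 / rad p in H1 *; set b := xi q ^+ 3 / rad q in H1 *.
  have -> : 6 * xi p - 3 * a - (6 * xi q - 3 * b) = 6 * (xi p - xi q) - 3 * (a - b).
    by ring.
  apply: le_trans (ler_normB _ _) _.
  by rewrite !normrM (@ger0_norm _ 6)// (@ger0_norm _ 3)//; lra.
- rewrite -mulrBr normrM (@ger0_norm _ (3 / 2)); last lra.
  by lra.
- rewrite -mulrBr normrM (@ger0_norm _ (3 / 2)); last lra.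
  by lra.
- by rewrite -mulrBr normrM (@ger0_norm _ 3)//; lra.
Qed.

Lemma continuous_solution_dd i j : continuous (@solution_dd R i j).
Proof. exact: (@holder_continuous _ _ 15) (solution_dd_holder i j). Qed.

Lemma continuous_solution_d i : continuous (@solution_d R i).
Proof.
have C0 (f : R * R -> R) : continuous f -> Ck setT 0 f by exact: continuous_Ck0.
apply: (@Ck_continuous _ 0); rewrite /solution_d; case: i.
  apply: Ck_mul; last exact/C0/continuous_xi.
  by apply: Ck_mul; [exact: Ck_cst|exact: Ck_snd].
apply: Ck_mul; first exact: Ck_cst.
exact/Ck_exp/C0/continuous_xi.
Qed.

Lemma continuous_solution : continuous (@solution R).
Proof.
have C0 (f : R * R -> R) : continuous f -> Ck setT 0 f by exact: continuous_Ck0.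
have cx := C0 _ (@continuous_xi R); have cr := C0 _ (@continuous_enorm R).
apply: (@Ck_continuous _ 0); rewrite /solution.
apply: Ck_sub; apply: Ck_mul; try exact: Ck_exp; try exact: Ck_cst.
by apply: Ck_mul => //; exact: Ck_cst.
Qed.

Lemma xi_gt0_rad p : 0 < xi p -> 0 < rad p.
Proof. by move=> x0; apply: lt_le_trans (xi_sqr_le p); rewrite exprn_gt0. Qed.

Lemma is_derive_enorm i p : 0 < rad p ->
  is_derive p (basis R i) rad ((p.1 * (basis R i).1 + p.2 * (basis R i).2) / rad p).
Proof.
move=> r0.
have H1 := is_derive_mul (is_derive_fst p i) (is_derive_fst p i).
have H2 := is_derive_mul (is_derive_snd p i) (is_derive_snd p i).
have s0 : 0 < p.1 * p.1 + p.2 * p.2.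
  by rewrite -!expr2 -enorm_sqr exprn_gt0.
have := @is_derive_sqrt _ _ (fun x : R * R => x.1 * x.1 + x.2 * x.2) p _ _ s0
  (is_derive_add H1 H2).
have -> : (fun x : R * R => Num.sqrt (x.1 * x.1 + x.2 * x.2)) = rad.
  by apply/funext => x; rewrite /enorm !expr2.
move=> H; apply: is_derive_eq H _; rewrite -!expr2 -[Num.sqrt _]/(rad p).
by field; rewrite gt_eqF.
Qed.

Lemma is_derive_xi i p : 0 < xi p ->
  is_derive p (basis R i) (@xi R)
    (if i then p.2 / (4 * rad p * xi p) else xi p / (2 * rad p)).
Proof.
move=> x0; have r0 := xi_gt0_rad x0.
have s0 : 0 < (rad p + p.1) * 2^-1 by rewrite -xi_sqr exprn_gt0.
have H := is_derive_mul (is_derive_add (is_derive_enorm i r0) (is_derive_fst p i))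
  (is_derive_cst (2^-1 : R) p (basis R i)).
have := @is_derive_sqrt _ _ (fun x : R * R => (rad x + x.1) * 2^-1) p _ _ s0 H.
rewrite -[Num.sqrt _]/(xi p).
move=> {}H; apply: is_derive_eq H _.
case: i => /=; first by field; rewrite !gt_eqF.
rewrite fst_parabolic; by field; rewrite !gt_eqF.
Qed.

Lemma is_derive_exp (V : normedModType R) (f : V -> R) (v w : V) (a : R) n :
  is_derive v w f a -> is_derive v w (fun x => f x ^+ n) (n%:R * f v ^+ n.-1 * a).
Proof.
move=> fa; rewrite (_ : (fun x => f x ^+ n) = f ^+ n); first exact: is_deriveX.
by apply/funext => x; rewrite exprfctE.
Qed.

Lemma is_derive_solution_pos i p : 0 < xi p ->
  is_derive p (basis R i) (@solution R) (solution_d i p).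
Proof.
move=> x0; have r0 := xi_gt0_rad x0.
have Dr := is_derive_enorm i r0; have Dx := is_derive_xi i x0.
have C (c : R) := is_derive_cst c p (basis R i).
have H1 := is_derive_mul (is_derive_mul (C 4) Dr) (is_derive_exp 3 Dx).
have H2 := is_derive_mul (C (16 / 5)) (is_derive_exp 5 Dx).
apply: is_derive_eq (is_derive_add H1 (is_derive_opp H2)) _.
rewrite /solution_d; case: i {Dr Dx C H1 H2} => /=.
  by field; rewrite !gt_eqF.
by rewrite fst_parabolic; field; rewrite !gt_eqF.
Qed.

Lemma is_derive_solution_d_pos i j p : 0 < xi p ->
  is_derive p (basis R j) (@solution_d R i) (solution_dd i j p).
Proof.
move=> x0; have r0 := xi_gt0_rad x0.
have Dx := is_derive_xi j x0.
have C (c : R) := is_derive_cst c p (basis R j).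
case: i; rewrite /solution_d.
  have H := is_derive_mul (is_derive_mul (C 3) (is_derive_snd p j)) Dx.
  apply: is_derive_eq H _.
  rewrite /solution_dd; case: j {Dx C} => /=; last by field; rewrite !gt_eqF.
  have y2 := snd_sqr_parabolic p.
  have -> : (0 * p.2 + 3 * 1) * xi p + 3 * p.2 * (p.2 / (4 * rad p * xi p)) =
    3 * xi p + 3 * p.2 ^+ 2 / (4 * rad p * xi p) by field; rewrite !gt_eqF.
  by rewrite y2; field; rewrite !gt_eqF.
have H := is_derive_mul (C 2) (is_derive_exp 3 Dx).
apply: is_derive_eq H _.
by rewrite /solution_dd; case: j {Dx C} => /=; field; rewrite !gt_eqF.
Qed.

(** Growth of order |t|^(3/2) forces a zero derivative. This replaces the chain rule on the slit,
    where [xi] vanishes and the root is not differentiable; the restriction |t| <= 1 allows a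
    constant depending on [p]. *)
Lemma is_derive0_bound p v (f : R * R -> R) (C : R) : f p = 0 ->
  (forall t : R, `|t| <= 1 -> `|f (t *: v + p)| <= C * `|t| * Num.sqrt `|t|) ->
  is_derive p v f 0.
Proof.
move=> fp H; apply: is_derive_cvg; apply/cvgrPdist_lt => e e0.
have cs : continuous (fun t : R => `|C| * Num.sqrt `|t|).
  move=> t; apply: cvgM; first exact: cvg_cst.
  apply: (@continuous_comp _ _ _ (fun t : R => `|t|) Num.sqrt);
    last exact: sqrt_continuous.
  exact: norm_continuous.
have := cs 0; rewrite /continuous_at normr0 sqrtr0 mulr0 => /cvgrPdist_lt/(_ e e0) He.
near=> t; rewrite fp subr0 sub0r normrN.
have t0 : t != 0 by near: t; exact: nbhs_dnbhs_neq.
have tp : 0 < `|t| by rewrite normr_gt0.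
have t1 : `|t| <= 1 by apply: ltW; near: t; apply: dnbhs0_lt.
have : `|0 - `|C| * Num.sqrt `|t| | < e by near: t; exact: nbhs_dnbhs He.
rewrite sub0r normrN (ger0_norm (mulr_ge0 (normr_ge0 C) (sqrtr_ge0 `|t|))).
apply: le_lt_trans; rewrite normrM normfV mulrC ler_pdivrMr//.
apply: le_trans (H t t1) _; rewrite -mulrA [leRHS]mulrAC -[leRHS]mulrA.
by rewrite ler_wpM2r ?ler_norm// mulr_ge0 ?sqrtr_ge0.
Unshelve. all: by end_near. Qed.

Lemma enorm_shift i (t : R) : rad (t *: basis R i) = `|t|.
Proof.
rewrite /enorm -sqrtr_sqr; congr Num.sqrt.
by case: i; rewrite /= /GRing.scale /= ?mulr0 ?mulr1 expr0n ?addr0 ?add0r.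
Qed.

Lemma xi_shift i p (t : R) : xi p = 0 -> xi (t *: basis R i + p) <= Num.sqrt `|t|.
Proof.
move=> x0; have := xi_holder (t *: basis R i + p) p.
by rewrite x0 subr0 addrK enorm_shift// => /(le_trans (ler_norm _)).
Qed.

Lemma xi_eq0_snd p : xi p = 0 -> p.2 = 0.
Proof.
by move=> x0; apply/eqP; rewrite -normr_eq0 snd_parabolic x0 mul0r mulr0.
Qed.

(** On the slit, a step of length |t| makes [xi] at most sqrt |t|, and the function is at most 4 |q|
    xi^3 at the new point q, with |q| <= |p| + 1. *)
Lemma is_derive_solution i p :
  is_derive p (basis R i) (@solution R) (solution_d i p).
Proof.
have := xi_ge0 p; rewrite le_eqVlt => /predU1P[/esym x0|];
  last exact: is_derive_solution_pos.
have -> : solution_d i p = 0.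
  by rewrite /solution_d x0; case: i; rewrite ?expr0n !mulr0.
apply: (@is_derive0_bound _ _ _ (4 * (rad p + 1))).
  by rewrite /solution x0 !expr0n !mulr0 subrr.
move=> t t1; set q := _ + p.
rewrite ger0_norm ?solution_ge0//; apply: le_trans (solution_le q) _.
have xq : xi q <= Num.sqrt `|t| := xi_shift i t x0.
have rq : rad q <= rad p + 1.
  by rewrite addrC; apply: le_trans (enormD _ _) _; rewrite enorm_shift// lerD2r.
have -> : 4 * (rad p + 1) * `|t| * Num.sqrt `|t| =
  4 * (rad p + 1) * Num.sqrt `|t| ^+ 3.
  by rewrite -mulrA; congr (_ * _); rewrite [RHS]exprSr sqr_sqrtr.
apply: ler_pM; rewrite ?mulr_ge0 ?exprn_ge0 ?xi_ge0 ?enorm_ge0//.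
  by rewrite ler_wpM2l.
by rewrite ler_pXn2r// nnegrE ?xi_ge0 ?sqrtr_ge0.
Qed.

(** On the slit p.2 = 0 as well, so after a step t both 3 p.2 xi and 2 xi^3 are at most 3 |t|^(3/2)
    in absolute value. *)
Lemma is_derive_solution_d i j p :
  is_derive p (basis R j) (@solution_d R i) (solution_dd i j p).
Proof.
have := xi_ge0 p; rewrite le_eqVlt => /predU1P[/esym x0|];
  last exact: is_derive_solution_d_pos.
have y0 := xi_eq0_snd x0.
have -> : solution_dd i j p = 0.
  by rewrite /solution_dd x0 y0; case: i; case: j;
    rewrite ?expr0n ?mulr0 ?mul0r ?mulr0 ?subrr.
apply: (@is_derive0_bound _ _ _ 3).
  by rewrite /solution_d x0; case: i; rewrite ?expr0n !mulr0.
move=> t t1; set q := _ + p.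
have xq : xi q <= Num.sqrt `|t| := xi_shift j t x0.
have X0 := xi_ge0 q; have T0 := sqrtr_ge0 `|t|.
have t2 : `|t| = Num.sqrt `|t| ^+ 2 by rewrite sqr_sqrtr.
case: i; rewrite /solution_d.
  have yq : `|q.2| <= `|t|.
    have -> : q.2 = t * (basis R j).2 by rewrite /q /= y0 addr0.
    by case: (j); rewrite /= ?mulr1 ?mulr0 ?normr0.
  rewrite !normrM (ger0_norm X0) (@ger0_norm _ 3)//.
  by apply: ler_pM => //; rewrite ?mulr_ge0// ler_wpM2l.
rewrite normrM (@ger0_norm _ 2)// ger0_norm ?exprn_ge0// -mulrA [X in 3 * (X * _)]t2.
rewrite -exprSr; apply: ler_pM => //; rewrite ?exprn_ge0//; first lra.
by rewrite ler_pXn2r// nnegrE.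
Qed.

Lemma Ck_solution : Ck setT 2 (@solution R).
Proof.
apply: (CkSI continuous_solution is_derive_solution) => i.
apply: (CkSI (@continuous_solution_d i) (is_derive_solution_d i)) => j.
exact/continuous_Ck0/continuous_solution_dd.
Qed.

Lemma partial_solution i : partial i (@solution R) = solution_d i.
Proof.
by apply/funext => p; rewrite /partial; case: (is_derive_solution i p).
Qed.

Lemma partial_solution_d i j : partial j (@solution_d R i) = solution_dd i j.
Proof.
by apply/funext => p; rewrite /partial; case: (is_derive_solution_d i j p).
Qed.

(** Openness makes continuity and derivatives depend only on values in [U]; this transfers
    regularity to [u], which is prescribed only on the closed disc. *)
Lemma CkHolder_ext (U : set (R * R)) (a : R) k (f g : R * R -> R) : open U ->
  (forall x, U x -> f x = g x) -> CkHolder U a k f -> CkHolder U a k g.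
Proof.
move=> oU; elim: k f g => [|k IH] f g fg /=; case=> fc [C fb] fk.
  split.
  - move=> x Ux; rewrite /prop_for /continuous_at -(fg _ Ux).
    apply: cvg_trans (fc x Ux); apply: near_eq_cvg.
    by near=> y; apply: fg; near: y; exact: (open_nbhs_nbhs (conj oU Ux)).
  - by exists C => x Ux; rewrite -(fg _ Ux); exact: fb.
  - by case: fk => C' fk; exists C' => x y Ux Uy;
    rewrite -(fg _ Ux) -(fg _ Uy); exact: fk.
split.
- move=> x Ux; rewrite /prop_for /continuous_at -(fg _ Ux).
  apply: cvg_trans (fc x Ux); apply: near_eq_cvg.
  by near=> y; apply: fg; near: y; exact: (open_nbhs_nbhs (conj oU Ux)).
- by exists C => x Ux; rewrite -(fg _ Ux); exact: fb.
move=> i; have [fd fH] := fk i.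
have nfg x : U x -> {near x, f =1 g}.
  by move=> Ux; near=> y; apply: fg; near: y; exact: (open_nbhs_nbhs (conj oU Ux)).
split; first by move=> x Ux; apply: near_eq_derivable (fd x Ux); exact: nfg.
by apply: IH fH => x Ux; apply: near_eq_derive; exact: nfg.
Unshelve. all: by end_near. Qed.

Lemma CkHolder_solution : CkHolder (disc R) (1 / 2) 2 (@solution R).
Proof.
have bd (f : R * R -> R) : continuous f -> exists C, forall x, disc R x -> `|f x| <= C.
  move=> cf; have [M HM] := continuous_bounded_disc cf; exists M => x Dx.
  exact: HM (ltW Dx).
split=> [x _| |i]; [exact: continuous_solution|exact/bd/continuous_solution|].
split=> [x _|]; first by case: (is_derive_solution i x).
rewrite partial_solution.
split=> [x _| |j]; [exact: continuous_solution_d|exact/bd/continuous_solution_d|].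
split=> [x _|]; first by case: (is_derive_solution_d i j x).
rewrite partial_solution_d.
split=> [x _| |]; [exact: continuous_solution_dd|exact/bd/continuous_solution_dd|].
exists 15 => x y _ _; rewrite div1r powR12_sqrt ?enorm_ge0//.
exact: solution_dd_holder.
Qed.

End SolutionCalculus.

(** * Polar form and homogeneity of the solution *)

Lemma polar_coordinates (R : realType) (p : R * R) :
  exists2 phi : R, - pi <= phi < pi &
    p = (enorm p * cos phi, enorm p * sin phi).
Proof.
have P0 := pi_gt0 R.
have [r0|rn0] := eqVneq (enorm p) 0.
  exists 0; first by apply/andP; split; lra.
  have := le_enorm1 p; have := le_enorm2 p.
  rewrite r0 !normr_le0 !mul0r => /eqP y0 /eqP x0.
  by case: p x0 y0 {r0} => x y /= -> ->.
have rp : 0 < enorm p by rewrite lt_neqAle eq_sym rn0 enorm_ge0.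
pose a := p.1 / enorm p.
have a1 : -1 <= a <= 1.
  rewrite -ler_norml normrM normfV (gtr0_norm rp) ler_pdivrMr// mul1r.
  exact: le_enorm1.
have ca : cos (acos a) = a by apply: acosK; rewrite in_itv.
have sa : enorm p * sin (acos a) = `|p.2|.
  apply/eqP; rewrite -(@eqrXn2 _ 2)//; last first.
    by rewrite mulr_ge0 ?enorm_ge0// sin_ge0_pi// acos_ge0// acos_lepi.
  rewrite exprMn sin2cos2 ca real_normK ?num_real//.
  have -> : enorm p ^+ 2 * (1 - a ^+ 2) = enorm p ^+ 2 - p.1 ^+ 2.
    by rewrite /a; field.
  by rewrite enorm_sqr addrC addKr.
have xa : p.1 = enorm p * cos (acos a) by rewrite ca /a mulrC divfK.
have [y0|y0] := ltP p.2 0.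
  exists (- acos a).
    have := acos_ge0 a1; have := acos_lepi a1 => h1 h2.
    by apply/andP; split; lra.
  rewrite cosN sinN -xa mulrN sa ltr0_norm// opprK.
  by case: (p).
(* The range of angles excludes pi, so points of the negative half-axis get the angle - pi. *)
have [api|api] := eqVneq (acos a) pi.
  exists (- pi); first by apply/andP; split; lra.
  rewrite cosN sinN sinpi oppr0 mulr0.
  move: xa sa; rewrite api sinpi mulr0 => xa /esym/eqP; rewrite normr_eq0 => /eqP ya.
  by case: (p) xa ya => x y /= {1}-> ->.
exists (acos a).
  have := acos_ge0 a1; have := acos_lepi a1 => h1 h2.
  by apply/andP; split; [lra|rewrite lt_neqAle api].
by rewrite -xa sa ger0_norm//; case: (p).
Qed.

(** The Chebyshev polynomial of degree 5, through two doublings and one addition. *)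
Lemma cos_mul5 (R : realType) (t : R) :
  cos (5 * t) = 16 * cos t ^+ 5 - 20 * cos t ^+ 3 + 5 * cos t.
Proof.
have e5 : 5 * t = (t *+ 2) *+ 2 + t by rewrite -!mulrnA mulr_natl -mulrSr.
rewrite e5 cosD cos_mulr2n sin_mulr2n cos_mulr2n sin_mulr2n.
have s2 := sin2cos2 t.
have -> : (cos t ^+ 2 *+ 2 - 1) ^+ 2 *+ 2 - 1 = 8 * cos t ^+ 4 - 8 * cos t ^+ 2 + 1.
  by ring.
have -> : ((cos t ^+ 2 *+ 2 - 1) * (cos t * sin t *+ 2)) *+ 2 * sin t =
  4 * (cos t ^+ 2 *+ 2 - 1) * cos t * sin t ^+ 2 by ring.
by rewrite s2; ring.
Qed.

Lemma powR5half (R : realType) (r : R) : 0 <= r -> r `^ (5 / 2) = Num.sqrt r ^+ 5.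
Proof.
move=> r0; have -> : 5 / 2 = 2^-1 * 5%:R :> R by rewrite mulrC.
by rewrite powRrM powR12_sqrt// powR_mulrn// sqrtr_ge0.
Qed.

Lemma enorm_polar (R : realType) (r phi : R) : 0 <= r ->
  enorm (r * cos phi, r * sin phi) = r.
Proof.
move=> r0; rewrite /enorm /= !exprMn -mulrDr cos2Dsin2 mulr1 sqrtr_sqr.
exact: ger0_norm.
Qed.

Lemma solution_polar (R : realType) (r phi : R) : 0 <= r -> - pi <= phi < pi ->
  solution (r * cos phi, r * sin phi) =
  r `^ (5 / 2) * (cos (phi / 2) - 1 / 5 * cos (5 * phi / 2)).
Proof.
move=> r0 /andP[ph1 ph2].
set t := phi / 2.
(* The half angle stays within [- pi / 2, pi / 2]; this sign makes the square root in [xi] return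
   sqrt r * cos t itself. *)
have c0 : 0 <= cos t by apply: cos_ge0_pihalf; apply/andP; split; rewrite /t; lra.
have xiE : xi (r * cos phi, r * sin phi) = Num.sqrt r * cos t.
  rewrite /xi enorm_polar//=.
  have -> : (r + r * cos phi) / 2 = r * cos t ^+ 2.
    have -> : phi = t *+ 2 by rewrite /t; field.
    by rewrite cos_mulr2n; field.
  by rewrite sqrtrM// sqrtr_sqr ger0_norm.
have -> : 5 * phi / 2 = 5 * t by rewrite /t mulrA.
rewrite powR5half// cos_mul5 /solution xiE enorm_polar//.
have {1}-> : r = Num.sqrt r ^+ 2 by rewrite sqr_sqrtr.
by field.
Qed.

(** Homogeneity of degree 5/2, from which the radial derivative at the boundary is read off. *)
Lemma solution_homogeneous (R : realType) (r : R) (p : R * R) : 0 <= r ->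
  solution (r * p.1, r * p.2) = Num.sqrt r ^+ 5 * solution p.
Proof.
move=> r0.
have eE : enorm (r * p.1, r * p.2) = r * enorm p.
  rewrite /enorm /= !exprMn -mulrDr sqrtrM ?sqr_ge0// sqrtr_sqr.
  by rewrite ger0_norm.
have xE : xi (r * p.1, r * p.2) = Num.sqrt r * xi p.
  by rewrite /xi eE /= -mulrDr -mulrA sqrtrM.
rewrite /solution eE xE.
have {1}-> : r = Num.sqrt r ^+ 2 by rewrite sqr_sqrtr.
by ring.
Qed.

(** * The function [u] satisfies its own constraints *)

Section Admissible.
Variables (R : realType) (u : R * R -> R).
Hypothesis u_polar : forall r phi : R, 0 <= r <= 1 -> - pi <= phi < pi ->
  u (r * cos phi, r * sin phi) =
  r `^ (5 / 2) * (cos (phi / 2) - 1 / 5 * cos (5 * phi / 2)).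
Notation mu := (@lebesgue_measure R).

(** [u] is unspecified outside the closed disc, whereas [solution] is C^2 on the whole plane as the
    smooth approximants must be. The circle is included because the boundary data are values of [u]
    there. *)
Lemma eq_solution (p : R * R) : enorm p <= 1 -> u p = solution p.
Proof.
move=> p1; have [phi phiP ->] := polar_coordinates p.
have r0 := enorm_ge0 p.
by rewrite u_polar ?r0// solution_polar.
Qed.

Lemma eq_solution_disc (p : R * R) : disc R p -> u p = solution p.
Proof. by move=> Dp; apply: eq_solution; exact: ltW. Qed.

Lemma eq_solution_circle (t : R) : u (circle_pt t) = solution (circle_pt t).
Proof. by apply: eq_solution; rewrite enorm_circle_pt. Qed.

Lemma measurable_obstacle : measurable_fun (disc R) u.
Proof.
apply: (eq_measurable_fun (@solution R)).
  by move=> p; rewrite inE => Dp; rewrite eq_solution_disc.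
by apply: continuous_measurable_disc; exact: continuous_solution.
Qed.

Lemma ae_eq_solution : ae_eq (leb2 R) (disc R) u (@solution R).
Proof. by apply: aeW => p Dp; exact: eq_solution_disc. Qed.

Lemma ae_eq_weak_partial i :
  ae_eq (leb2 R) (disc R) (weak_partial i u) (@solution_d R i).
Proof.
rewrite -partial_solution.
apply: weak_partial_smooth (CkW (@Ck_solution R)) _ _.
  exact: measurable_obstacle.
exact: ae_eq_solution.
Qed.

Lemma Ck_solution_d i : Ck setT 1 (@solution_d R i).
Proof. by rewrite -partial_solution; apply: CkS_partial; exact: Ck_solution. Qed.

Lemma measurable_weak_partial i : measurable_fun (disc R) (weak_partial i u).
Proof.
have H := is_weak_partial_smooth i (CkW (@Ck_solution R)) measurable_obstacle
  ae_eq_solution.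
by have [_ []] := weak_partialP H.
Qed.

Lemma ae_eq_weak_partial2 i j :
  ae_eq (leb2 R) (disc R) (weak_partial j (weak_partial i u))
    (@solution_dd R i j).
Proof.
rewrite -partial_solution_d.
apply: weak_partial_smooth (Ck_solution_d i) _ _.
  exact: measurable_weak_partial.
exact: ae_eq_weak_partial.
Qed.

(** With s = sqrt r, homogeneity turns the quotient into (s^5 - 1) / (s^2 - 1) times the boundary
    value; cancelling s - 1 leaves (s^4 + s^3 + s^2 + s + 1) / (s + 1), which tends to 5/2. *)
Lemma normal_derivative_solution (t : R) :
  normal_derivative u t = 5 / 2 * solution (circle_pt t).
Proof.
pose s (r : R) : R := Num.sqrt r.
have cs : continuous s by exact: sqrt_continuous.
pose G (r : R) := (s r ^+ 4 + s r ^+ 3 + s r ^+ 2 + s r + 1) / (s r + 1) *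
  solution (circle_pt t).
have cG : G r @[r --> 1^'-] --> 5 / 2 * solution (circle_pt t).
  have -> : 5 / 2 * solution (circle_pt t) = G 1.
    by rewrite /G /s sqrtr1 !expr1n; congr (_ / _ * _); ring.
  apply: cvg_at_left_filter; apply: cvgM; last exact: cvg_cst.
  have cX n : s r ^+ n @[r --> (1 : R)] --> s 1 ^+ n.
    apply: (@continuous_comp _ _ _ s (fun x => x ^+ n)); first exact: cs.
    exact: exprn_continuous.
  apply: cvgM.
    apply: cvgD; last exact: cvg_cst.
    apply: cvgD; last exact: cs.
    by apply: cvgD; first apply: cvgD; exact: cX.
  apply: cvgV; first by rewrite gt_eqF// ltr_wpDl// sqrtr_ge0.
  by apply: cvgD; [exact: cs|exact: cvg_cst].
apply/cvg_lim => //; apply: cvg_trans cG; apply: near_eq_cvg.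
near=> r.
have r1 : r < 1 by near: r; exact: nbhs_left_lt.
have r0 : 0 < r by near: r; apply: nbhs_left_gt.
rewrite eq_solution_circle eq_solution ?enorm_polar ?ltW//.
rewrite (solution_homogeneous (circle_pt t) (ltW r0)) /G.
have rE : r = s r ^+ 2 by rewrite sqr_sqrtr// ltW.
have s0 : 0 <= s r by exact: sqrtr_ge0.
have s1 : s r - 1 != 0.
  rewrite subr_eq0; apply/eqP => s1; move: r1.
  by rewrite rE s1 expr1n ltxx.
have -> : r - 1 = (s r - 1) * (s r + 1) by rewrite {1}rE; ring.
rewrite -/(s r); field.
by rewrite s1 gt_eqF// ltr_wpDl.
Unshelve. all: by end_near. Qed.

(** Euler's relation for degree 5/2, identifying the trace of the gradient along the normal with the
    one-sided radial limit. *)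
Lemma solution_euler (t : R) :
  solution_d false (circle_pt t) * cos t + solution_d true (circle_pt t) * sin t =
  5 / 2 * solution (circle_pt t).
Proof.
have := fst_parabolic (circle_pt t); have := snd_sqr_parabolic (circle_pt t).
rewrite /solution_d /solution enorm_circle_pt /= => s2 ->.
set x := xi _ in s2 *.
have -> : 3 * sin t * x * sin t = 3 * x * sin t ^+ 2 by ring.
by rewrite s2; field.
Qed.

Lemma admissible_obstacle : admissible u u.
Proof.
have mu_ := measurable_obstacle; have aeu := ae_eq_solution.
have C2 := @Ck_solution R.
split.
- exact: sobolev2_smooth C2 mu_ aeu.
- by apply: aeW => p Dp; rewrite eq_solution_disc//; exact: solution_ge0.
- under eq_fun do rewrite eq_solution_circle.
  exact: has_trace_smooth (CkW C2) mu_ aeu.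
- exists (fun i t => solution_d i (circle_pt t)); split.
    move=> i; apply: has_trace_smooth (Ck_solution_d i) _ _.
      exact: measurable_weak_partial.
    exact: ae_eq_weak_partial.
  by apply: aeW => t _; rewrite normal_derivative_solution solution_euler.
Qed.

End Admissible.

(** * The variational inequality *)

Section Regularisation.
Variables (R : realType) (e : R).
Hypothesis e0 : 0 < e.
Implicit Types (p : R * R) (i j : bool).

Local Notation rad := (@enorm R).

(* The smooth function 6 sqrt ((sqrt (|p|^2 + e^2) + x) / 2) regularises
   the Laplacian 6 xi of the solution and is still subharmonic. *)
Definition reg_rad p : R := Num.sqrt (p.1 ^+ 2 + p.2 ^+ 2 + e ^+ 2).

Definition reg_xi p : R := Num.sqrt ((reg_rad p + p.1) / 2).

Definition reg p : R := 6 * reg_xi p.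

Definition reg_d i p : R :=
  if i then 3 / 2 * p.2 * (reg_rad p * reg_xi p)^-1
  else 3 * reg_xi p * (reg_rad p)^-1.

Definition reg_laplacian p : R :=
  partial false (partial false reg) p + partial true (partial true reg) p.

Lemma reg_arg_gt0 p : 0 < p.1 ^+ 2 + p.2 ^+ 2 + e ^+ 2.
Proof. by rewrite ltr_wpDl ?addr_ge0 ?sqr_ge0 ?exprn_gt0. Qed.

Lemma reg_rad_gt0 p : 0 < reg_rad p.
Proof. by rewrite sqrtr_gt0 reg_arg_gt0. Qed.

Lemma reg_rad_sqr p : reg_rad p ^+ 2 = p.1 ^+ 2 + p.2 ^+ 2 + e ^+ 2.
Proof. by rewrite sqr_sqrtr// ltW// reg_arg_gt0. Qed.

Lemma enorm_lt_reg_rad p : rad p < reg_rad p.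
Proof.
rewrite /enorm /reg_rad ltr_sqrt ?reg_arg_gt0// ltrDl exprn_gt0//.
Qed.

Lemma reg_rad_le p : reg_rad p <= rad p + e.
Proof.
rewrite -(@ler_pXn2r _ 2)// ?nnegrE ?(ltW (reg_rad_gt0 p))//; last first.
  by rewrite addr_ge0 ?enorm_ge0 ?ltW.
rewrite reg_rad_sqr; have := enorm_sqr p; have := enorm_ge0 p => r0 r2.
by have := mulr_ge0 r0 (ltW e0); nra.
Qed.

Lemma reg_rad_ge p : e <= reg_rad p.
Proof.
rewrite -(@ler_pXn2r _ 2)// ?nnegrE ?(ltW (reg_rad_gt0 p)) ?(ltW e0)//.
by rewrite reg_rad_sqr lerDr addr_ge0 ?sqr_ge0.
Qed.

Lemma reg_xi_arg_gt0 p : 0 < (reg_rad p + p.1) / 2.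
Proof.
have := enorm_lt_reg_rad p; have := le_enorm1 p.
by rewrite ler_norml => /andP[]; lra.
Qed.

Lemma reg_xi_gt0 p : 0 < reg_xi p.
Proof. by rewrite sqrtr_gt0 reg_xi_arg_gt0. Qed.

Lemma reg_xi_sqr p : reg_xi p ^+ 2 = (reg_rad p + p.1) / 2.
Proof. by rewrite sqr_sqrtr// ltW// reg_xi_arg_gt0. Qed.

Lemma xi_le_reg_xi p : xi p <= reg_xi p.
Proof.
by apply: ler_wsqrtr; have := enorm_lt_reg_rad p; lra.
Qed.

Lemma reg_xi_sqr_le p : reg_xi p ^+ 2 <= reg_rad p.
Proof.
rewrite reg_xi_sqr; have := enorm_lt_reg_rad p; have := le_enorm1 p.
by rewrite ler_norml => /andP[]; lra.
Qed.

(** Uniform in [p], since [reg_rad] exceeds the Euclidean length by at most e and the square root is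
    1/2-Hoelder. *)
Lemma reg_close p : `|reg p - 6 * xi p| <= 6 * Num.sqrt e.
Proof.
rewrite /reg -mulrBr normrM (@ger0_norm _ 6)// ler_wpM2l//.
apply: le_trans (sqrt_holder (ltW (reg_xi_arg_gt0 p)) (xi_arg_ge0 p)) _.
apply: ler_wsqrtr.
have := enorm_lt_reg_rad p; have := reg_rad_le p; have := e0.
by rewrite ler_norml => *; apply/andP; split; lra.
Qed.

Lemma Ck_reg_rad k : Ck setT k reg_rad.
Proof.
apply: Ck_sqrt; first exact: reg_arg_gt0.
by apply: Ck_add; [apply: Ck_add; apply: Ck_exp; [exact: Ck_fst|exact: Ck_snd]|
  exact: Ck_cst].
Qed.

Lemma Ck_reg k : Ck setT k reg.
Proof.
apply: Ck_mul; first exact: Ck_cst.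
apply: Ck_sqrt; first exact: reg_xi_arg_gt0.
apply: Ck_mul; last exact: Ck_cst.
by apply: Ck_add; [exact: Ck_reg_rad|exact: Ck_fst].
Qed.

Lemma is_derive_reg_rad i p : is_derive p (basis R i) reg_rad
  ((p.1 * (basis R i).1 + p.2 * (basis R i).2) / reg_rad p).
Proof.
have r0 := reg_rad_gt0 p.
have H1 := is_derive_exp 2 (is_derive_fst p i).
have H2 := is_derive_exp 2 (is_derive_snd p i).
have H := is_derive_add (is_derive_add H1 H2) (is_derive_cst (e ^+ 2) p (basis R i)).
have := @is_derive_sqrt _ _ (fun x : R * R => x.1 ^+ 2 + x.2 ^+ 2 + e ^+ 2) p _ _
  (reg_arg_gt0 p) H.
move=> {}H; apply: is_derive_eq H _; rewrite -[Num.sqrt _]/(reg_rad p) /=.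
by field; rewrite gt_eqF.
Qed.

Lemma is_derive_reg_xi i p : is_derive p (basis R i) reg_xi
  (if i then p.2 / (4 * reg_rad p * reg_xi p) else reg_xi p / (2 * reg_rad p)).
Proof.
have x0 := reg_xi_gt0 p; have r0 := reg_rad_gt0 p.
have H := is_derive_mul (is_derive_add (is_derive_reg_rad i p) (is_derive_fst p i))
  (is_derive_cst (2^-1 : R) p (basis R i)).
have := @is_derive_sqrt _ _ (fun x : R * R => (reg_rad x + x.1) * 2^-1) p _ _
  (reg_xi_arg_gt0 p) H.
rewrite -[Num.sqrt _]/(reg_xi p) => {}H; apply: is_derive_eq H _.
case: i => /=; first by field; rewrite !gt_eqF.
have -> : p.1 = 2 * reg_xi p ^+ 2 - reg_rad p by rewrite reg_xi_sqr; field.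
by field; rewrite !gt_eqF.
Qed.

Lemma partial_reg i : partial i reg = reg_d i.
Proof.
apply/funext => p; rewrite /partial.
have := is_derive_mul (is_derive_cst (6 : R) p (basis R i)) (is_derive_reg_xi i p).
have x0 := reg_xi_gt0 p; have r0 := reg_rad_gt0 p.
by case=> _ ->; rewrite /reg_d; case: (i); field; rewrite !gt_eqF.
Qed.

(** The closed form displays the sign, and the power of [reg_xi] in the denominator that the
    obstacle solution must compensate. *)
Lemma reg_laplacianE p : reg_laplacian p =
  3 / 8 * e ^+ 2 * (4 * reg_xi p ^+ 2 + reg_rad p) / (reg_rad p * reg_xi p) ^+ 3.
Proof.
have x0 := reg_xi_gt0 p; have r0 := reg_rad_gt0 p.
rewrite /reg_laplacian !partial_reg.
have C i (c : R) := is_derive_cst c p (basis R i).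
have Dr i := is_derive_reg_rad i p; have Dx i := is_derive_reg_xi i p.
have n1 : reg_rad p * reg_xi p != 0 by rewrite mulf_neq0// gt_eqF.
have n2 : reg_rad p != 0 by rewrite gt_eqF.
have H1 := is_derive_mul (is_derive_mul (C false 3) (Dx false))
  (@is_derive_inv _ _ reg_rad p _ _ n2 (Dr false)).
have H2 := is_derive_mul (is_derive_mul (C true (3 / 2)) (is_derive_snd p true))
  (@is_derive_inv _ _ (fun x => reg_rad x * reg_xi x) p _ _ n1
    (is_derive_mul (Dr true) (Dx true))).
rewrite /partial; case: H1 => _ ->; case: H2 => _ ->; rewrite /=.
have x1 : p.1 = 2 * reg_xi p ^+ 2 - reg_rad p by rewrite reg_xi_sqr; field.
(* Eliminating e^2 and p.1 in favour of [reg_rad], [reg_xi] and p.2 leaves a rational identity in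
   independent quantities. *)
have e2 : e ^+ 2 = reg_rad p ^+ 2 - p.2 ^+ 2 - p.1 ^+ 2 by rewrite reg_rad_sqr; ring.
by rewrite e2 x1; field; rewrite !gt_eqF.
Qed.

Lemma reg_laplacian_ge0 p : 0 <= reg_laplacian p.
Proof.
have x0 := ltW (reg_xi_gt0 p); have r0 := ltW (reg_rad_gt0 p).
rewrite reg_laplacianE divr_ge0//; last by rewrite exprn_ge0// mulr_ge0.
rewrite mulr_ge0//; first by rewrite mulr_ge0// sqr_ge0.
by rewrite addr_ge0// mulr_ge0// sqr_ge0.
Qed.

(** The bound by 4 [reg_rad] [reg_xi]^3 cancels [reg_xi] from the denominator and leaves (3/2) e^2
    (4 [reg_xi]^2 + [reg_rad]) / [reg_rad]^2. As [reg_xi]^2 and e are at most [reg_rad], this is at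
    most (3/2) * 5 * e. *)
Lemma solution_reg_laplacian p : solution p * reg_laplacian p <= 15 / 2 * e.
Proof.
have x0 := reg_xi_gt0 p; have r0 := reg_rad_gt0 p.
have L0 := reg_laplacian_ge0 p.
have U : solution p <= 4 * reg_rad p * reg_xi p ^+ 3.
  apply: le_trans (solution_le p) _; apply: ler_pM.
  - by rewrite mulr_ge0// enorm_ge0.
  - by rewrite exprn_ge0// xi_ge0.
  - by rewrite ler_wpM2l// ltW// enorm_lt_reg_rad.
  - by rewrite ler_pXn2r ?nnegrE ?xi_ge0 ?(ltW x0)// xi_le_reg_xi.
apply: le_trans (ler_wpM2r L0 U) _; rewrite reg_laplacianE.
have -> : 4 * reg_rad p * reg_xi p ^+ 3 * (3 / 8 * e ^+ 2 *
    (4 * reg_xi p ^+ 2 + reg_rad p) / (reg_rad p * reg_xi p) ^+ 3) =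
  3 / 2 * e ^+ 2 * (4 * reg_xi p ^+ 2 + reg_rad p) / reg_rad p ^+ 2.
  by field; rewrite !gt_eqF.
rewrite ler_pdivrMr ?exprn_gt0//.
have E : e ^+ 2 * (4 * reg_xi p ^+ 2 + reg_rad p) <= e ^+ 2 * (5 * reg_rad p).
  by rewrite ler_wpM2l ?sqr_ge0//; have := reg_xi_sqr_le p; lra.
have F : e * (e * reg_rad p) <= e * (reg_rad p * reg_rad p).
  by rewrite ler_wpM2l ?(ltW e0)// ler_wpM2r ?(ltW r0)// reg_rad_ge.
by rewrite -!mulrA; nra.
Qed.

End Regularisation.

Lemma ae_imply d (T : measurableType d) (R : realType)
    (mu : {measure set T -> \bar R}) (P Q : T -> Prop) :
  (forall x, P x -> Q x) -> {ae mu, forall x, P x} -> {ae mu, forall x, Q x}.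
Proof. by move=> PQ; apply: filterS. Qed.

Lemma Rintegral_ae_ge0 d (T : measurableType d) (R : realType)
    (mu : {measure set T -> \bar R}) (D : set T) (f : T -> R) :
  measurable D -> measurable_fun D f ->
  {ae mu, forall x, D x -> 0 <= f x} -> 0 <= \int[mu]_(x in D) f x.
Proof.
move=> mD mf f0; rewrite (@ae_eq_Rintegral _ _ _ mu D mD f (fun x => `|f x|)) //.
- by apply: Rintegral_ge0 => x _.
- exact: measurableT_comp.
- by apply: filterS f0 => x H Dx; rewrite ger0_norm// H.
Qed.

(** * Comparison of an arbitrary competitor with [u] *)

Section Variational.
Variables (R : realType) (u : R * R -> R).
Hypothesis u_polar : forall r phi : R, 0 <= r <= 1 -> - pi <= phi < pi ->
  u (r * cos phi, r * sin phi) =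
  r `^ (5 / 2) * (cos (phi / 2) - 1 / 5 * cos (5 * phi / 2)).
Variable v : R * R -> R.
Hypothesis Av : admissible u v.
Notation mu := (@lebesgue_measure R).
Notation mD := (@measurable_disc R).

Let Au : admissible u u := admissible_obstacle u_polar.

Let dd (f : R * R -> R) i j := weak_partial j (weak_partial i f).

Let w p := v p - u p.

(** A difference of the derivatives chosen for [v] and for [u], not of those chosen for v - u: it
    matches the two energies pointwise, with no appeal to linearity of the choice. *)
Let lap p := (dd v false false p - dd u false false p) +
  (dd v true true p - dd u true true p).

(** Both traces are the same function of the angle, so their difference vanishes everywhere. The
    normal traces agree with [normal_derivative u] only almost everywhere, and the two exceptional
    sets are united. *)
Lemma difference_traceable : exists dw h g,
  [/\ traceable w dw g,
      forall i, traceable (dw i) (fun j p => dd v i j p - dd u i j p) (h i),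
      forall t, g t = 0 &
      {ae mu, forall t : R, - pi <= t <= pi ->
        h false t * cos t + h true t * sin t = 0}].
Proof.
have [_ _ tv [hv [thv hvE]]] := Av; have [_ _ tu [hu [thu huE]]] := Au.
exists (fun i p => weak_partial i v p - weak_partial i u p).
exists (fun i t => hv i t - hu i t).
exists (fun t => u (circle_pt t) - u (circle_pt t)).
split.
- exact: traceable_sub (has_trace_traceable tv) (has_trace_traceable tu).
- move=> i.
  exact: traceable_sub (has_trace_traceable (thv i)) (has_trace_traceable (thu i)).
- by move=> t; rewrite subrr.
- have [N [mN N0 subN]] := hvE; have [N' [mN' N0' subN']] := huE.
  exists (N `|` N'); split.
  + exact: measurableU.
  + by rewrite null_set_setU.
  + move=> t /= tN; have [tN1|tN1] := pselect (N t); [by left|right].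
    apply: subN' => /= H'; apply: tN => tpi.
    have H : hv false t * cos t + hv true t * sin t = normal_derivative u t.
      apply: contrapT => H; apply: tN1; apply: subN => /= H1; exact: H (H1 tpi).
    by rewrite !mulrBl addrACA -opprD H H' ?subrr.
Qed.

Let wL : L2 w.
Proof. by have [dw [h [g [[]]]]] := difference_traceable. Qed.

Let ddvL i j : L2 (dd v i j).
Proof.
have [_ _ _ [hv [thv _]]] := Av.
by have [_ + _ _] := has_trace_traceable (thv i); exact.
Qed.

Let dduL i j : L2 (dd u i j).
Proof.
have [_ _ _ [hu [thu _]]] := Au.
by have [_ + _ _] := has_trace_traceable (thu i); exact.
Qed.

Let lapL : L2 lap.
Proof.
apply: (square_integrable_add mD).
  exact: (square_integrable_sub mD (ddvL _ _) (dduL _ _)).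
exact: (square_integrable_sub mD (ddvL _ _) (dduL _ _)).
Qed.

Let oneL : L2 (fun=> 1 : R).
Proof. by apply: continuous_L2 => x; exact: cvg_cst. Qed.

Let lapI : (leb2 R).-integrable (disc R) (EFin \o lap).
Proof. by have := L2_mul lapL oneL; under eq_fun do rewrite mulr1. Qed.

Let continuous_6xi : continuous (fun p => 6 * @xi R p).
Proof. by move=> p; apply: cvgM; [exact: cvg_cst|exact: continuous_xi]. Qed.

Lemma Green_reg (e : R) : 0 < e ->
  \int[leb2 R]_(p in disc R) (reg e p * lap p) =
  \int[leb2 R]_(p in disc R) (reg_laplacian e p * w p).
Proof.
move=> e0; have [dw [h [g [wT dwT g0 h0]]]] := difference_traceable.
exact: (Green_laplacian wT dwT g0 h0 (Ck_reg e0 2)).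
Qed.

Lemma reg_laplacian_lower (e : R) : 0 < e ->
  0 <= \int[leb2 R]_(p in disc R) (reg e p * lap p) +
       15 / 2 * e * \int[leb2 R]_(p in disc R) (1 : R).
Proof.
move=> e0; rewrite Green_reg//.
have cl : continuous (reg_laplacian e).
  have K i := CkS_partial i (CkS_partial i (Ck_reg e0 2)).
  exact: (Ck_continuous (Ck_add (K false) (K true))).
have iw := L2_mul (continuous_L2 cl) wL.
have one : (leb2 R).-integrable (disc R) (EFin \o (fun=> 1 : R)).
  by apply: integrable_disc_continuous => x; exact: cvg_cst.
have i1 : (leb2 R).-integrable (disc R) (EFin \o (fun=> 15 / 2 * e * 1)).
  by apply: integrable_disc_continuous => x; exact: cvg_cst.
rewrite -RintegralZl//; last exact: mD.
rewrite -RintegralD//; last exact: mD.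
apply: Rintegral_ae_ge0; first exact: mD.
  apply: measurable_funD => //; apply: measurable_funM; last exact: wL.1.
  exact: continuous_measurable_disc.
have [_ v0 _ _] := Av; apply: ae_imply v0 => p v0 Dp.
rewrite mulr1 /w (eq_solution_disc u_polar Dp) mulrBr.
have := mulr_ge0 (reg_laplacian_ge0 e0 p) (v0 Dp).
have := solution_reg_laplacian e0 p.
by rewrite [solution p * _]mulrC; lra.
Qed.

(** Taking e = s^2 turns the approximation error 6 sqrt e into 6 s, so that 0 <= I + 6 s A + (15/2)
    s^2 B for every s > 0; a negative [I] is refuted by an explicit small s. *)
Lemma variational_inequality :
  0 <= \int[leb2 R]_(p in disc R) (6 * xi p * lap p).
Proof.
set I := \int[leb2 R]_(p in disc R) _.
set A := \int[leb2 R]_(p in disc R) `|lap p|.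
set B := \int[leb2 R]_(p in disc R) (1 : R).
have A0 : 0 <= A by apply: Rintegral_ge0.
have B0 : 0 <= B by apply: Rintegral_ge0.
have key (s : R) : 0 < s -> 0 <= I + 6 * s * A + 15 / 2 * s ^+ 2 * B.
  move=> s0; have e0 : 0 < s ^+ 2 by rewrite exprn_gt0.
  apply: le_trans (reg_laplacian_lower e0) _; rewrite lerD2r.
  have iA := integrable_norm lapI.
  have cr := Ck_continuous (Ck_reg e0 0).
  have iI := L2_mul (continuous_L2 continuous_6xi) lapL.
  have iQ := L2_mul (continuous_L2 cr) lapL.
  have iA' := integrableZl mD (6 * s) iA.
  have iR := integrableD mD iI iA'.
  have -> : I + 6 * s * A =
      \int[leb2 R]_(p in disc R) (6 * xi p * lap p + 6 * s * `|lap p|).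
    by rewrite RintegralD; [rewrite RintegralZl; [|exact: mD|]|exact: mD| |].
  apply: le_Rintegral => //; first exact: mD.
  move=> p _; rewrite -lerBlDl -mulrBl; apply: le_trans (ler_norm _) _.
  rewrite normrM ler_wpM2r//; apply: le_trans (reg_close e0 p) _.
  by rewrite sqrtr_sqr ger0_norm// ltW.
rewrite leNgt; apply/negP => I0.
pose c := 6 * A + 15 / 2 * B + 1.
have c0 : 0 < c by rewrite /c; lra.
(* With this choice the error terms amount to at most t * c = - I / 2; the minimum with 1 taken
   below ensures s^2 <= s. *)
pose t := - I / (2 * c).
have t0 : 0 < t by rewrite divr_gt0// ?oppr_gt0// mulr_gt0.
have tc : t * c = - I / 2 by rewrite /t; field; rewrite gt_eqF.
pose s := Num.min 1 t.
have s0 : 0 < s by rewrite lt_min ltr01.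
have s1 : s <= 1 by rewrite ge_min lexx.
have st : s <= t by rewrite ge_min lexx orbT.
have := key s s0.
have h1 : s ^+ 2 * B <= s * B by rewrite ler_wpM2r// expr2 ger_pMr.
have h2 : s * c <= t * c by rewrite ler_wpM2r// ltW.
have h3 : s * c = 6 * (s * A) + 15 / 2 * (s * B) + s by rewrite /c; ring.
rewrite -!mulrA; lra.
Qed.

Lemma weak_laplacianE f p :
  weak_laplacian f p = dd f true true p + dd f false false p.
Proof. by rewrite /weak_laplacian big_bool. Qed.

(** Finiteness of the energy allows the comparison to be carried out in real arithmetic. *)
Lemma bienergyE f : (forall i j, L2 (dd f i j)) ->
  bienergy f = (\int[leb2 R]_(p in disc R) (weak_laplacian f p ^+ 2))%:E.
Proof.
move=> fL; rewrite /bienergy /Rintegral fineK//.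
apply: integrable_fin_num; first exact: mD.
have L : L2 (weak_laplacian f).
  rewrite (_ : weak_laplacian f = fun p => dd f true true p + dd f false false p).
    exact: (square_integrable_add mD (fL _ _) (fL _ _)).
  by apply/funext => p; exact: weak_laplacianE.
exact: (square_integrableP mD L).
Qed.

(** By construction the Laplacian of [v] is pointwise that of [u] plus [lap], so the square expands
    exactly; only the cross term uses the identification with 6 xi. *)
Lemma bienergy_expansion :
  \int[leb2 R]_(p in disc R) (weak_laplacian v p ^+ 2) =
  \int[leb2 R]_(p in disc R) (weak_laplacian u p ^+ 2) +
  2 * \int[leb2 R]_(p in disc R) (6 * xi p * lap p) +
  \int[leb2 R]_(p in disc R) (lap p ^+ 2).
Proof.
have E f : weak_laplacian f = fun p => dd f true true p + dd f false false p.
  by apply/funext => p; exact: weak_laplacianE.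
have uL : L2 (weak_laplacian u).
  by rewrite E; exact: (square_integrable_add mD (dduL _ _) (dduL _ _)).
have iu := square_integrableP mD uL.
have il := square_integrableP mD lapL.
have iul := L2_mul uL lapL.
have i2 := integrableZl mD 2 iul.
have i12 := integrableD mD iu i2.
have -> : \int[leb2 R]_(p in disc R) (6 * xi p * lap p) =
          \int[leb2 R]_(p in disc R) (weak_laplacian u p * lap p).
  apply: (ae_eq_Rintegral mD).
  - apply: measurable_funM; last exact: lapL.1.
    exact: continuous_measurable_disc.
  - by apply: measurable_funM; [exact: uL.1|exact: lapL.1].
  - have a1 := ae_eq_weak_partial2 u_polar true true.
    have a2 := ae_eq_weak_partial2 u_polar false false.
    apply: filterS2 a1 a2 => p H1 H2 Dp; congr (_ * _).
    by rewrite weak_laplacianE /dd H1// H2// /solution_dd subrK.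
rewrite -RintegralZl//; last exact: mD.
rewrite -RintegralD//; last exact: mD.
rewrite -RintegralD//; last exact: mD.
have aux (a b c d : R) : a + b = c + d + ((b - d) + (a - c)) by ring.
have sq (a b : R) : (a + b) ^+ 2 = a ^+ 2 + 2 * (a * b) + b ^+ 2 by ring.
apply: eq_Rintegral => p _; rewrite -sq; congr (_ ^+ 2).
rewrite !weak_laplacianE; exact: aux.
Qed.

Let laplacian_square_ge0 : 0 <= \int[leb2 R]_(p in disc R) (lap p ^+ 2).
Proof. by apply: Rintegral_ge0 => p _; exact: sqr_ge0. Qed.

Lemma bienergy_le : (bienergy u <= bienergy v)%E.
Proof.
have aux (A B : \bar R) (a b c d : R) : A = a%:E -> B = b%:E ->
    b = a + 2 * c + d -> 0 <= c -> 0 <= d -> (A <= B)%E.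
  by move=> -> -> -> c0 d0; rewrite lee_fin; lra.
exact: (aux _ _ _ _ _ _ (bienergyE dduL) (bienergyE ddvL) bienergy_expansion
  variational_inequality laplacian_square_ge0).
Qed.

Lemma minimiser_unique : (bienergy v <= bienergy u)%E ->
  {ae leb2 R, forall x, disc R x -> v x = u x}.
Proof.
move=> vu.
have aux (A B : \bar R) (a b c d : R) : A = a%:E -> B = b%:E ->
    b = a + 2 * c + d -> 0 <= c -> 0 <= d -> (B <= A)%E -> d = 0.
  by move=> -> -> -> c0 d0; rewrite lee_fin; lra.
have l0 := aux _ _ _ _ _ _ (bienergyE dduL) (bienergyE ddvL) bienergy_expansion
  variational_inequality laplacian_square_ge0 vu.
have [dw [h [g [wT dwT g0 h0]]]] := difference_traceable.
have lap0 := Rintegral_square_eq0 mD lapL l0.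
have := null_laplacian wT dwT g0 lap0.
by apply: filterS => p H Dp; apply/eqP; rewrite -subr_eq0; apply/eqP; exact: H.
Qed.

End Variational.

Theorem mainTheorem3 (R : realType) (u : R * R -> R)
    (u_polar : forall r phi : R, 0 <= r <= 1 -> - pi <= phi < pi ->
      u (r * cos phi, r * sin phi) =
      r `^ (5 / 2) * (cos (phi / 2) - 1 / 5 * cos (5 * phi / 2))) :
  CkHolder (disc R) (1 / 2) 2 u /\
  minimiser (@bienergy R) (admissible u) u /\
  (forall v, minimiser (@bienergy R) (admissible u) v ->
     {ae leb2 R, forall x, disc R x -> v x = u x}).
Proof.
have Au := admissible_obstacle u_polar.
split; [|split].
- apply: (CkHolder_ext (@open_disc R)) (@CkHolder_solution R) => p Dp.
  by rewrite (eq_solution_disc u_polar).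
- split; first exact: Au.
  by move=> v Av; exact: (bienergy_le u_polar Av).
- by move=> v [Av vmin]; exact: (minimiser_unique u_polar Av (vmin u Au)).
Qed.
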